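(* Let $(\bar A,\bar B,\bar C)$ be a structural system with $n$ states, $p$ inputs and $m$ outputs, let $\mathcal K\subseteq\{1,\dots,m\}\times\{1,\dots,p\}$ be a set of communication links (sensor, actuator), and let $\{\Gamma_i\}_{i\in\Delta}$ be a collection of possible communication failures, $\Gamma_i\subset\mathcal K$. The structural system $(\bar A,\bar B,\bar C;\mathcal K,\{\Gamma_i\}_{i\in\Delta})$ has no resilient structurally fixed modes if and only if both of the following conditions hold for all $i\in\Delta$: (a) in the digraph $\mathcal D(\bar A,\bar B,\bar C;\mathcal K,\Gamma_i)=(\mathcal X\cup\mathcal U\cup\mathcal Y,\ \mathcal E_{\mathcal X,\mathcal X}\cup\mathcal E_{\mathcal X,\mathcal Y}\cup\mathcal E_{\mathcal U,\mathcal X}\cup(\mathcal E_{\mathcal Y,\mathcal U}\setminus\mathcal E_{\Gamma_i}))$, each state vertex $x\in\mathcal X$ is contained in a strongly connected component which includes an edge of $\mathcal E_{\mathcal Y,\mathcal U}\setminus\mathcal E_{\Gamma_i}$; (b) there exists a disjoint union of (vertex-disjoint, directed) cycles $\mathcal C_j=(\mathcal V_j,\mathcal E_j)$, $j=1,\dots,k$ with $k\in\mathbb N$, that is a subgraph of $\mathcal D(\bar A,\bar B,\bar C;\mathcal K,\Gamma_i)$ and satisfies $\mathcal X\subset\bigcup_{j=1}^k\mathcal V_j$.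
   Context: Closed-loop system: $x[k+1]=(A+BKC)x[k]$ with $A\in\mathbb R^{n\times n}$, $B\in\mathbb R^{n\times p}$, $C\in\mathbb R^{m\times n}$, $K\in\mathbb R^{p\times m}$. A structural system $(\bar A,\bar B,\bar C)$ consists of binary matrices $\bar A\in\{0,1\}^{n\times n}$, $\bar B\in\{0,1\}^{n\times p}$, $\bar C\in\{0,1\}^{m\times n}$ giving sparsity patterns; $[\bar M]$ denotes the set of real matrices of the same size as $\bar M$ that vanish wherever $\bar M$ is zero (the other entries are free real parameters). ''Almost all'' means outside a set of Lebesgue measure zero in the space of free parameters. A pair $(j,i)\in\mathcal K$ means that the measurement of sensor $j$ is available to actuator $i$. The information pattern $\bar K(\mathcal K)\in\{0,1\}^{p\times m}$ has $\bar K_{i,j}=1$ if $(j,i)\in\mathcal K$ and $0$ otherwise. For $\Gamma\subset\mathcal K$ put $[\bar K(\mathcal K)]^{\Gamma}_{p,m}=\{K\in\mathbb R^{p\times m}: K_{l,k}=0\text{ if }(k,l)\notin\mathcal K\text{ or }(k,l)\in\Gamma\}$. Resilient fixed modes: $\Sigma(A,B,C;\mathcal K,\{\Gamma_i\}_{i\in\Delta})=\bigcup_{i\in\Delta}\ \bigcap_{K\in[\bar K(\mathcal K)]^{\Gamma_i}_{p,m}}\sigma(A+BKC)$, where $\sigma$ is the set of (complex) eigenvalues. $(\bar A,\bar B,\bar C;\mathcal K,\{\Gamma_i\}_{i\in\Delta})$ has resilient structurally fixed modes (with respect to $\bar K(\mathcal K)$) if $\Sigma(A,B,C;\mathcal K,\{\Gamma_i\}_{i\in\Delta})\neq\emptyset$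 for almost all $A\in[\bar A]$, $B\in[\bar B]$, $C\in[\bar C]$. Digraph: $\mathcal X=\{x_1,\dots,x_n\}$, $\mathcal U=\{u_1,\dots,u_p\}$, $\mathcal Y=\{y_1,\dots,y_m\}$; $\mathcal E_{\mathcal X,\mathcal X}=\{(x_i,x_j):\bar A_{ji}\ne0\}$, $\mathcal E_{\mathcal U,\mathcal X}=\{(u_j,x_i):\bar B_{ij}\neq0\}$, $\mathcal E_{\mathcal X,\mathcal Y}=\{(x_i,y_j):\bar C_{ji}\neq0\}$, $\mathcal E_{\mathcal Y,\mathcal U}=\{(y_j,u_i):\bar K(\mathcal K)_{ij}\neq0\}$, and $\mathcal E_{\Gamma_i}=\{(y_j,u_l):(j,l)\in\Gamma_i\}$. *)

(* Defs.v *)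
From HB Require Import structures.
From mathcomp Require Import all_boot all_order all_algebra.
From mathcomp Require Import complex.
From mathcomp Require Import boolp classical_sets reals ereal topology.
From mathcomp Require Import measure lebesgue_measure lebesgue_integral numfun.
From mathcomp Require Import measurable_realfun.

Set Implicit Arguments.
Unset Strict Implicit.
Unset Printing Implicit Defensive.

Import Order.TTheory GRing.Theory Num.Theory.

Local Open Scope classical_set_scope.
Local Open Scope ring_scope.

(** * Lebesgue measure on [R^N] *)

(* The iterated product measure on [R^N], via [R^(N+1) = R * R^N]; [R^0] is a
   single point of mass 1. *)
Fixpoint lebesgue_tuple (R : realType) (N : nat) :
    set (N.-tuple (measurableTypeR R)) -> \bar R :=
  match N with
  | 0 => dirac [tuple]
  | N'.+1 => fun E => (@lebesgue_measure R \x @lebesgue_tuple R N')%E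
      [set xt : measurableTypeR R * N'.-tuple (measurableTypeR R) |
         E [tuple of xt.1 :: xt.2]]
  end.

Lemma lebesgue_tuple_box (R : realType) N (B : 'I_N -> set (measurableTypeR R)) :
  (forall i, measurable (B i)) ->
  lebesgue_tuple [set t | forall i, B i (tnth t i)] =
    (\prod_(i < N) lebesgue_measure (B i))%E.
Proof.
elim: N B => [|N IH] B mB /=.
  rewrite big_ord0 diracE mem_set //= => -[].
  by [].
rewrite big_ord_recl.
rewrite /product_measure1.
transitivity (\int[@lebesgue_measure R]_x ((\prod_(i < N) lebesgue_measure (B (lift ord0 i)))%E * (\1_(B ord0) x)%:E))%E.
  apply: eq_integral => x _ /=.
  rewrite -(IH (fun i => B (lift ord0 i))) //.
  rewrite indicE; case: (boolP (x \in B ord0)) => xB.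
    rewrite mule1; congr lebesgue_tuple; apply/seteqP; split=> t /=.
      rewrite /xsection /= inE => /= H i. have := H (lift ord0 i). by rewrite tnthS.
    rewrite /xsection /= inE => /= H i.
    case: (unliftP ord0 i) => [j ->|->]; first by rewrite tnthS.
    by rewrite tnth0; exact: set_mem.
  rewrite mule0. rewrite (_ : xsection _ _ = set0).
    clear. elim: N => [|N IH]/=; first by rewrite dirac0.
    rewrite /product_measure1 integral0_eq // => x _ /=.
    by rewrite (_ : xsection _ _ = set0) //; apply/seteqP; split => // t; rewrite /xsection /= inE.
  apply/seteqP; split => // t; rewrite /xsection /= inE => /= /(_ ord0). rewrite tnth0 => h.
  by case/negP: xB; exact: mem_set.
rewrite ge0_integralZl //.
- by rewrite integral_indic // setIT muleC.
- by apply/measurable_EFinP; exact: measurable_indic.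
- by elim/big_ind: _ => // *; apply: mule_ge0.
Qed.

(** * Structural systems *)

Definition structured (R : realType) (r c : nat) (Mbar : 'M[bool]_(r, c)) :
    set 'M[R]_(r, c) :=
  [set M | forall i j, Mbar i j = false -> M i j = 0].

(* Positions in a triple (A, B, C), in this order. *)
Definition position (n p m : nat) : finType :=
  (('I_n * 'I_n) + ('I_n * 'I_p) + ('I_m * 'I_n))%type.

Definition free_positions (n p m : nat) (Abar : 'M[bool]_n)
    (Bbar : 'M[bool]_(n, p)) (Cbar : 'M[bool]_(m, n)) :
    {set position n p m} :=
  [set q : position n p m |
    match q with
    | inl (inl (i, j)) => Abar i j
    | inl (inr (i, j)) => Bbar i j
    | inr (i, j) => Cbar i j
    end]%SET.

Definition entry (R : realType) (n p m : nat) (A : 'M[R]_n)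
    (B : 'M[R]_(n, p)) (C : 'M[R]_(m, n)) (q : position n p m) : R :=
  match q with
  | inl (inl (i, j)) => A i j
  | inl (inr (i, j)) => B i j
  | inr (i, j) => C i j
  end.

(* On triples (A, B, C) with the given sparsity patterns this is a bijection
   onto the space of free parameters. *)
Definition free_params (R : realType) (n p m : nat) (Abar : 'M[bool]_n)
    (Bbar : 'M[bool]_(n, p)) (Cbar : 'M[bool]_(m, n)) (A : 'M[R]_n)
    (B : 'M[R]_(n, p)) (C : 'M[R]_(m, n)) :
    #|free_positions Abar Bbar Cbar|.-tuple (measurableTypeR R) :=
  [tuple entry A B C (enum_val k) | k < #|free_positions Abar Bbar Cbar|].

Definition for_almost_all (R : realType) (n p m : nat) (Abar : 'M[bool]_n)
    (Bbar : 'M[bool]_(n, p)) (Cbar : 'M[bool]_(m, n))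
    (P : 'M[R]_n -> 'M[R]_(n, p) -> 'M[R]_(m, n) -> Prop) : Prop :=
  (@lebesgue_tuple R #|free_positions Abar Bbar Cbar|).-negligible
    [set t | exists A B C,
       [/\ [/\ structured Abar A, structured Bbar B & structured Cbar C],
           ~ P A B C & t = free_params Abar Bbar Cbar A B C]].

(** * Resilient fixed modes *)

Definition spectrum (R : realType) (n : nat) (M : 'M[R]_n) : set R[i] :=
  [set z | eigenvalue (map_mx (real_complex R) M) z].

(* A communication link (j, l) goes from sensor j to actuator l, whereas rows
   of a gain matrix are indexed by actuators and columns by sensors. *)
Definition info_pattern (p m : nat) (links : {set 'I_m * 'I_p}) :
    'M[bool]_(p, m) :=
  \matrix_(l, j) ((j, l) \in links).

Definition gains (R : realType) (p m : nat)
    (links failed : {set 'I_m * 'I_p}) : set 'M[R]_(p, m) :=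
  [set K | forall (l : 'I_p) (k : 'I_m),
     (k, l) \notin links \/ (k, l) \in failed -> K l k = 0].

Definition resilient_fixed_modes (R : realType) (n p m : nat) (A : 'M[R]_n)
    (B : 'M[R]_(n, p)) (C : 'M[R]_(m, n)) (links : {set 'I_m * 'I_p})
    (Delta : Type) (Gamma : Delta -> {set 'I_m * 'I_p}) : set R[i] :=
  \bigcup_(i in [set: Delta]) \bigcap_(K in @gains R p m links (Gamma i))
    spectrum (A + B *m K *m C).

Definition has_resilient_structurally_fixed_modes (R : realType)
    (n p m : nat) (Abar : 'M[bool]_n) (Bbar : 'M[bool]_(n, p))
    (Cbar : 'M[bool]_(m, n)) (links : {set 'I_m * 'I_p})
    (Delta : Type) (Gamma : Delta -> {set 'I_m * 'I_p}) : Prop :=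
  @for_almost_all R n p m Abar Bbar Cbar (fun A B C =>
    resilient_fixed_modes A B C links Gamma !=set0).

(** * The system digraph *)

Definition vertex (n p m : nat) : finType := ('I_n + 'I_p + 'I_m)%type.

Section Digraph.
Variables n p m : nat.

Definition state_vertex (i : 'I_n) : vertex n p m := inl (inl i).
Definition input_vertex (l : 'I_p) : vertex n p m := inl (inr l).
Definition output_vertex (j : 'I_m) : vertex n p m := inr j.

Definition edges_XX (Abar : 'M[bool]_n) : {set vertex n p m * vertex n p m} :=
  [set (state_vertex ij.1, state_vertex ij.2) | ij : 'I_n * 'I_n & Abar ij.2 ij.1]%SET.

Definition edges_UX (Bbar : 'M[bool]_(n, p)) :
    {set vertex n p m * vertex n p m} :=
  [set (input_vertex ij.2, state_vertex ij.1) | ij : 'I_n * 'I_p & Bbar ij.1 ij.2]%SET.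

Definition edges_XY (Cbar : 'M[bool]_(m, n)) :
    {set vertex n p m * vertex n p m} :=
  [set (state_vertex ji.2, output_vertex ji.1) | ji : 'I_m * 'I_n & Cbar ji.1 ji.2]%SET.

Definition edges_YU (Kbar : 'M[bool]_(p, m)) :
    {set vertex n p m * vertex n p m} :=
  [set (output_vertex ij.2, input_vertex ij.1) | ij : 'I_p * 'I_m & Kbar ij.1 ij.2]%SET.

Definition edges_failed (failed : {set 'I_m * 'I_p}) :
    {set vertex n p m * vertex n p m} :=
  [set (output_vertex jl.1, input_vertex jl.2) | jl in failed]%SET.

Definition feedback_edges (links failed : {set 'I_m * 'I_p}) :
    {set vertex n p m * vertex n p m} :=
  edges_YU (info_pattern links) :\: edges_failed failed.

Definition system_edges (Abar : 'M[bool]_n) (Bbar : 'M[bool]_(n, p))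
    (Cbar : 'M[bool]_(m, n)) (links failed : {set 'I_m * 'I_p}) :
    {set vertex n p m * vertex n p m} :=
  edges_XX Abar :|: edges_XY Cbar :|: edges_UX Bbar
    :|: feedback_edges links failed.

End Digraph.

(** * Strongly connected components and disjoint unions of cycles *)

Section Components.
Variables (V : finType) (E : {set V * V}).

(* Paths may have length 0, so singletons are strongly connected. *)
Definition strongly_connected (S : {set V}) : bool :=
  [forall u in S, forall v in S,
     connect [rel a b | [&& a \in S, b \in S & (a, b) \in E]] u v].

Definition is_scc (S : {set V}) : bool :=
  (S != finset.set0) && maxset strongly_connected S.

(* [is_cycle c]: [c] lists the successive, pairwise distinct vertices of a
   directed cycle; self-loops are the cycles of length 1. *)
Definition is_cycle (c : seq V) : Prop :=
  c <> [::] /\ ucycle [rel a b | (a, b) \in E] c.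

End Components.

Section Conditions.
Variables (n p m : nat) (Abar : 'M[bool]_n) (Bbar : 'M[bool]_(n, p)).
Variables (Cbar : 'M[bool]_(m, n)) (links failed : {set 'I_m * 'I_p}).

Definition states_in_feedback_sccs : Prop :=
  forall i : 'I_n, exists S : {set vertex n p m},
    [/\ is_scc (system_edges Abar Bbar Cbar links failed) S,
        state_vertex p m i \in S &
        exists e : vertex n p m * vertex n p m,
          [/\ e \in feedback_edges n links failed, e.1 \in S & e.2 \in S]].

Definition states_covered_by_disjoint_cycles : Prop :=
  exists (k : nat) (c : 'I_k -> seq (vertex n p m)),
    [/\ forall j, is_cycle (system_edges Abar Bbar Cbar links failed) (c j),
        forall j1 j2 v, v \in c j1 -> v \in c j2 -> j1 = j2 &
        forall i : 'I_n, exists j, state_vertex p m i \in c j].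

End Conditions.

(* Main.v *)
(* For real gains K, the modes of A + BKC are the zeros z of a determinant chi
   over the vertices of the system digraph: diagonal entries z on the states and
   1 on inputs and outputs, minus the weighted adjacency matrix. By the Leibniz
   expansion only edges lying on closed walks matter, and chi is affine in the
   edges entering any given vertex.

   Necessity holds for every triple (A, B, C). If the strongly connected
   component of some state has no feedback edge, then the eigenvalues of the
   corresponding block of A do not depend on K; if the states are not covered by
   disjoint cycles, then every term of chi vanishes at z = 0.

   For sufficiency, call a set S of edges fixed if, for all weights outside S,
   some z is a zero of chi for all weights on S. Suppose that the feedback edges
   are fixed, and enlarge them to a maximal fixed set S. If an edge e lies
   outside S, the common zero moves injectively with the weight t of e; as
   chi = (1 - t) chi_0 + t chi_1, the ratio of chi_0 and chi_1 is then
   independent of the weights on S. Evaluating this on weights supported by one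
   or two cycles shows that every cycle lies in S or avoids S, and that cycles
   of the two kinds share no vertex, which contradicts the first condition. So S
   contains all edges; taking all weights zero, the common zero is z = 0, which
   contradicts the second condition.

   Hence some two gain matrices give disjoint spectra for one (A, B, C), i.e. a
   Sylvester operator is invertible; its determinant is a polynomial in the free
   parameters, and the product of these over all failure sets is nonzero on a
   box. *)

Require Import Defs.
From mathcomp Require Import all_boot all_order all_fingroup all_algebra.
From mathcomp Require Import boolp ring.

Set Implicit Arguments.
Unset Strict Implicit.
Unset Printing Implicit Defensive.

Import Order.TTheory GRing.Theory Num.Theory.

Local Open Scope ring_scope.

(** * Polynomial functions *)

(** Functions rather than formal polynomials: determinants of matrix families enter directly, and
    the variables can be indexed by any type. *)
Inductive polyfun (F : comNzRingType) (I : Type) : ((I -> F) -> F) -> Prop :=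
| polyfun_cst c : polyfun (fun=> c)
| polyfun_proj i : polyfun (fun x => x i)
| polyfun_add f g : polyfun f -> polyfun g -> polyfun (fun x => f x + g x)
| polyfun_mul f g : polyfun f -> polyfun g -> polyfun (fun x => f x * g x)
| polyfun_ext f g : polyfun f -> f =1 g -> polyfun g.

Section PolyfunRing.
Variables (F : comNzRingType) (I : Type).
Implicit Types f g : (I -> F) -> F.

Lemma polyfun_opp f : polyfun f -> polyfun (fun x => - f x).
Proof.
move=> pf; apply: (polyfun_ext (polyfun_mul (polyfun_cst _ (-1)) pf)) => x.
by rewrite mulN1r.
Qed.

Lemma polyfun_sum J (r : seq J) (P : pred J) (G : J -> (I -> F) -> F) :
  (forall j, P j -> polyfun (G j)) -> polyfun (fun x => \sum_(j <- r | P j) G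
    j x).
Proof.
move=> pG; elim: r => [|j r IH].
  by apply: (polyfun_ext (polyfun_cst _ 0)) => x; rewrite big_nil.
case Pj: (P j); last by apply: (polyfun_ext IH) => x; rewrite big_cons Pj.
by apply: (polyfun_ext (polyfun_add (pG j Pj) IH)) => x; rewrite big_cons Pj.
Qed.

Lemma polyfun_prod J (r : seq J) (P : pred J) (G : J -> (I -> F) -> F) :
  (forall j, P j -> polyfun (G j)) -> polyfun (fun x => \prod_(j <- r | P j) G
    j x).
Proof.
move=> pG; elim: r => [|j r IH].
  by apply: (polyfun_ext (polyfun_cst _ 1)) => x; rewrite big_nil.
case Pj: (P j); last by apply: (polyfun_ext IH) => x; rewrite big_cons Pj.
by apply: (polyfun_ext (polyfun_mul (pG j Pj) IH)) => x; rewrite big_cons Pj.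
Qed.

Definition polymx m n (A : (I -> F) -> 'M[F]_(m, n)) :=
  forall i j, polyfun (fun x => A x i j).

Lemma polymx_cst m n (A : 'M[F]_(m, n)) : polymx (fun=> A).
Proof. by move=> i j; apply: polyfun_cst. Qed.

Lemma polymx_add m n (A B : (I -> F) -> 'M[F]_(m, n)) :
  polymx A -> polymx B -> polymx (fun x => A x + B x).
Proof.
move=> pA pB i j; apply: (polyfun_ext (polyfun_add (pA i j) (pB i j))) => x.
by rewrite mxE.
Qed.

Lemma polymx_mul m n k (A : (I -> F) -> 'M[F]_(m, n))
    (B : (I -> F) -> 'M[F]_(n, k)) :
  polymx A -> polymx B -> polymx (fun x => A x *m B x).
Proof.
move=> pA pB i j.
apply: (@polyfun_ext _ _ (fun x => \sum_l A x i l * B x l j)).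
  by apply: polyfun_sum => l _; apply: polyfun_mul.
by move=> x; rewrite mxE.
Qed.

Lemma polyfun_det n (A : (I -> F) -> 'M[F]_n) :
  polymx A -> polyfun (fun x => \det (A x)).
Proof.
move=> pA; apply: polyfun_sum => s _; apply: polyfun_mul;
  first exact: polyfun_cst.
by apply: polyfun_prod.
Qed.

(** Restriction to a polynomial curve reduces nonvanishing to counting roots of a univariate
    polynomial. *)
Lemma polyfun_line f (u : I -> {poly F}) : polyfun f ->
  exists q : {poly F}, forall t, f (fun i => (u i).[t]) = q.[t].
Proof.
elim=> {f} [c|i|f g _ [p Hp] _ [q Hq]|f g _ [p Hp] _ [q Hq]|f g _ [p Hp] fg].
- by exists c%:P => t; rewrite hornerC.
- by exists (u i).
- by exists (p + q) => t; rewrite hornerD Hp Hq.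
- by exists (p * q) => t; rewrite hornerM Hp Hq.
- by exists p => t; rewrite -fg.
Qed.

Lemma polyfun_eq_arg (f : (I -> F) -> F) x y : polyfun f -> x =1 y -> f x = f y.
Proof.
move=> pf xy; elim: pf => {f} [c|i|f g _ Hf _ Hg|f g _ Hf _ Hg|f g _ Hf fg] //.
- by rewrite Hf Hg.
- by rewrite Hf Hg.
- by rewrite -!fg.
Qed.

End PolyfunRing.

Section PolyfunField.
Variable F : fieldType.
Hypothesis F0 : [pchar F] =i pred0.

Lemma natr_inj_pchar0 (k l : nat) : k%:R = l%:R :> F -> k = l.
Proof.
wlog le : k l / (k <= l)%N.
  by move=> W; case: (leqP k l) => [/W//|/ltnW /W H /esym /H].
move=> e; apply/eqP; rewrite eqn_leq le /= -subn_eq0.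
rewrite -((pcharf0P F).1 F0).
by rewrite natrB // e subrr.
Qed.


Lemma poly0_inj_nat (q : {poly F}) (z : nat -> F) : injective z ->
  (forall k, q.[z k] = 0) -> q = 0.
Proof.
move=> zi qz; apply/eqP; apply: contraT => q0.
have := @max_poly_roots _ q [seq z k | k <- iota 0 (size q)] q0.
rewrite size_map size_iota ltnn; apply.
  by apply/allP => _ /mapP[k _ ->]; rewrite /root qz.
by rewrite map_inj_uniq ?iota_uniq.
Qed.

Lemma poly_nat_nonroot (q : {poly F}) : q != 0 -> exists k : nat, q.[k%:R] != 0.
Proof.
move=> q0.
have [/allPn[k _ hk]|H] :=
  boolP (~~ all (fun k : nat => q.[k%:R] == 0) (iota 0 (size q))).
  by exists k.
suff: false by [].
have := @max_poly_roots _ q [seq k%:R | k : nat <- iota 0 (size q)] q0.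
rewrite size_map size_iota ltnn; apply.
  by apply/allP => _ /mapP[k ks ->]; move/negPn/allP: H => /(_ k ks).
by rewrite map_inj_uniq ?iota_uniq //; apply: natr_inj_pchar0.
Qed.

(** On the line from [x] to [y] both functions become nonzero univariate polynomials, and so does
    their product. *)
Lemma polyfun_nz2 I (f g : (I -> F) -> F) x y : polyfun f -> polyfun g ->
  f x != 0 -> g y != 0 -> exists2 z, f z != 0 & g z != 0.
Proof.
move=> pf pg fx gy.
pose u i := (x i)%:P + (y i - x i) *: 'X.
have u0 i : (u i).[0] = x i by rewrite /u hornerD hornerZ hornerC hornerX
  mulr0 addr0.
have u1 i : (u i).[1] = y i by rewrite /u hornerD hornerZ hornerC hornerX
  mulr1 addrC subrK.
have [p Hp] := polyfun_line u pf; have [q Hq] := polyfun_line u pg.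
have p0 : p != 0.
  by apply: contraNneq fx => p0; rewrite -(@polyfun_eq_arg _ _ _ (fun i => (u
    i).[0]) _ pf u0) Hp p0 horner0.
have q0 : q != 0.
  by apply: contraNneq gy => q0; rewrite -(@polyfun_eq_arg _ _ _ (fun i => (u
    i).[1]) _ pg u1) Hq q0 horner0.
have /poly_nat_nonroot[k] : p * q != 0 by rewrite mulf_neq0.
by rewrite hornerM mulf_eq0 negb_or => /andP[hp hq];
  exists (fun i => (u i).[k%:R]); rewrite ?Hp ?Hq.
Qed.

Lemma polyfun_nz_seq I (J : eqType) (s : seq J) (G : J -> (I -> F) -> F) :
  (forall j, polyfun (G j)) -> {in s, forall j, exists x, G j x != 0} ->
  exists x, {in s, forall j, G j x != 0}.
Proof.
move=> pG nG.
suff [x Hx] : exists x, \prod_(j <- s) G j x != 0.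
  exists x => j js; apply: contraNneq Hx => G0.
  by rewrite (big_rem j) //= G0 mul0r.
elim: s nG => [|j s IH] nG.
  by exists (fun=> 0); rewrite big_nil oner_neq0.
have [x Hx] := nG j (mem_head _ _).
have [|y Hy] := IH; first by move=> k ks; apply: nG; rewrite inE ks orbT.
have pP : polyfun (fun x => \prod_(j <- s) G j x) by apply: polyfun_prod.
have [z z1 z2] := polyfun_nz2 (pG j) pP Hx Hy.
by exists z; rewrite big_cons mulf_neq0.
Qed.

(** Coordinates are replaced by naturals one at a time. Naturals live in both the reals and the
    complex numbers, so a complex witness turns into a real one. *)
Lemma polyfun_nat_nz (I : finType) (f : (I -> F) -> F) x : polyfun f ->
  f x != 0 ->
  exists k : I -> nat, f (fun i => (k i)%:R) != 0.
Proof.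
move=> pf fx.
suff H (s : seq I) : exists2 y, f y != 0 & {in s, forall i, exists k :
  nat, y i = k%:R}.
  have [y fy H1] := H (enum I).
  have H2 i : exists k : nat, y i == k%:R.
    by have [k ->] := H1 i (mem_enum I i); exists k.
  exists (fun i => xchoose (H2 i)).
  rewrite -(@polyfun_eq_arg _ _ _ y) // => i; apply/eqP;
    exact: (xchooseP (H2 i)).
elim: s => [|i s [y fy ys]]; first by exists x.
pose u j := if j == i then 'X else (y j)%:P.
have [q Hq] := polyfun_line u pf.
have q0 : q != 0.
  apply: contraNneq fy => q0.
  rewrite (@polyfun_eq_arg _ _ _ y (fun j => (u j).[y i])) ?Hq ?q0 ?horner0 //
    => j.
  by rewrite /u; case: eqP => [->|_]; rewrite ?hornerX ?hornerC.
have [k Hk] := poly_nat_nonroot q0.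
exists (fun i => (u i).[k%:R]); first by rewrite Hq.
move=> j; rewrite inE /u; case: eqP => [_ _|_ /= js].
  by exists k; rewrite hornerX.
by have [l hl] := ys j js; exists l; rewrite hornerC.
Qed.

End PolyfunField.

(** * Characteristic determinant of a weighted digraph *)

Section WeightedDigraph.
Variables (L : fieldType) (V : finType) (X : pred V).
Implicit Types (z : L) (w : V * V -> L) (a b : V).

Definition dw z a := if X a then z else 1.

(** Rows are indexed by heads of edges and columns by tails, so in the equations of a left kernel
    vector the value at a tail collects the values at the heads. *)
Definition pmx z w : 'M[L]_#|V| :=
  \matrix_(i, j) (dw z (enum_val i) *+ (i == j) - w (enum_val j, enum_val i)).

Definition chi z w := \det (pmx z w).

Definition supp w : rel V := [rel a b | w (a, b) != 0].

Lemma eq_chi z w w' : w =1 w' -> chi z w = chi z w'.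
Proof. by move=> e; congr (\det _); apply/matrixP => i j; rewrite !mxE e. Qed.

Lemma chi0P z w :
  reflect (exists2 v : V -> L, (exists a, v a != 0) &
             forall a, dw z a * v a = \sum_b w (a, b) * v b)
          (chi z w == 0).
Proof.
have row (v : 'rV[L]_#|V|) j : (v *m pmx z w) 0 j =
    v 0 j * dw z (enum_val j) - \sum_b w (enum_val j, b) * v 0 (enum_rank b).
  rewrite mxE (eq_bigr (fun i => v 0 i * dw z (enum_val i) *+ (i == j)
     - w (enum_val j, enum_val i) * v 0 i)); last first.
    by move=> i _; rewrite mxE mulrBr mulrnAr [in X in _ - X]mulrC.
  rewrite sumrB; congr (_ - _).
    by rewrite (bigD1 j) //= eqxx big1 ?addr0 // => i /negPf ->.
  rewrite [RHS](reindex (@enum_val V V)) /=; last first.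
    by apply: onW_bij; exists enum_rank; [exact: enum_valK|exact: enum_rankK].
  by apply: eq_bigr => i _; rewrite enum_valK.
apply: (iffP (@det0P _ _ _)) => [[v v0 vP]|[v [a va] vP]].
  exists (fun a => v 0 (enum_rank a)).
    have /rV0Pn[i vi] := v0; exists (enum_val i); by rewrite enum_valK.
  move=> a; have := row v (enum_rank a); rewrite vP mxE enum_rankK.
  by move/esym/eqP; rewrite subr_eq0 mulrC => /eqP.
exists (\row_i v (enum_val i)).
  by apply/rV0Pn; exists (enum_rank a); rewrite mxE enum_rankK.
apply/rowP => j; rewrite row mxE [RHS]mxE mulrC vP; apply/eqP.
rewrite subr_eq0; apply/eqP; apply: eq_bigr => b _.
by rewrite mxE enum_rankK.
Qed.

(** The edges run from [s j] to [j], against [s]. Going around the orbit of [i] in that direction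
    leads from [i] to [s i], since [s] has finite order. *)
Lemma connect_perm_supp w (s : {perm 'I_#|V|}) (i : 'I_#|V|) :
  (forall j, s j = j \/ w (enum_val (s j), enum_val j) != 0) ->
  connect (supp w) (enum_val i) (enum_val (s i)).
Proof.
move=> H.
have iter_con k j : connect (supp w) (enum_val ((s ^+ k)%g j)) (enum_val j).
  elim: k => [|k IH]; first by rewrite expg0 perm1 connect0.
  rewrite expgSr permM; apply: connect_trans IH; set l := (s ^+ k)%g j.
  by case: (H l) => [->|wl]; [exact: connect0|exact: connect1].
have := iter_con #[s]%g.-1 (s i).
by rewrite -permM -expgS prednK ?order_gt0 // expg_order perm1.
Qed.

(* Only edges lying on closed walks contribute to the Leibniz expansion. *)
Lemma chi_prune z w w' :
  (forall a b, w' (a, b) = w (a, b) \/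
     w' (a, b) = 0 /\ ~~ connect (supp w) b a) ->
  chi z w = chi z w'.
Proof.
move=> H; apply: eq_bigr => s _; congr (_ * _).
(* A nonzero term uses only edges on closed walks, where [w] and [w'] agree. A zero term stays zero,
   because [w'] is [w] with some weights set to zero. *)
have [/forallP Hs|] := boolP [forall i, pmx z w i (s i) != 0].
  apply: eq_bigr => i _; rewrite !mxE.
  have [->//|[_]] := H (enum_val (s i)) (enum_val i).
  rewrite connect_perm_supp // => j.
  have := Hs j; rewrite mxE; case: (eqVneq j (s j)) => [<- _|_]; first by left.
  by rewrite mulr0n sub0r oppr_eq0; right.
rewrite negb_forall => /existsP[i]; rewrite negbK => Hi.
rewrite (bigD1 i) //= (eqP Hi) mul0r (bigD1 i) //=.
suff -> : pmx z w' i (s i) = 0 by rewrite mul0r.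
move: Hi; rewrite !mxE; case: (eqVneq i (s i)) => [<-|_].
  have [->//|[_]] := H (enum_val i) (enum_val i); last by rewrite connect0.
  by move/eqP.
rewrite !mulr0n !sub0r oppr_eq0 => /eqP w0.
by have [->|[->]] := H (enum_val (s i)) (enum_val i); rewrite ?w0 oppr0.
Qed.

Lemma chi_zero z : chi z (fun=> 0) = \prod_a dw z a.
Proof.
transitivity (\det (diag_mx (\row_(i < #|V|) dw z (enum_val i)))).
  by congr (\det _); apply/matrixP => i j; rewrite !mxE subr0.
rewrite det_diag [RHS](reindex (@enum_val V V)) /=; last first.
  by apply: onW_bij; exists enum_rank; [exact: enum_valK|exact: enum_rankK].
by apply: eq_bigr => i _; rewrite mxE.
Qed.

(** Every edge is pruned, which leaves the diagonal; at [z = 1] it is 1 on all vertices, states or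
    not. *)
Lemma chi_acyclic w :
  (forall a b, w (a, b) != 0 -> ~~ connect (supp w) b a) -> chi 1 w = 1.
Proof.
move=> H; rewrite (@chi_prune _ _ (fun=> 0)) => [|a b].
  by rewrite chi_zero big1 // => a _; rewrite /dw if_same.
by have [->|/H] := eqVneq (w (a, b)) 0; [left|right].
Qed.

(* All edges entering [a] sit in one row of [pmx]. *)
Lemma chi_row_affine z w w1 w2 t a :
  (forall b c, c != a -> w1 (b, c) = w (b, c) /\ w2 (b, c) = w (b, c)) ->
  (forall b, w (b, a) = (1 - t) * w1 (b, a) + t * w2 (b, a)) ->
  chi z w = (1 - t) * chi z w1 + t * chi z w2.
Proof.
move=> H1 H2; apply: (@determinant_multilinear _ _ _ _ _ (enum_rank a)).
- apply/rowP => j; rewrite !mxE enum_rankK H2 !mulrBr addrACA -mulrDl subrK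
    mul1r.
  by rewrite opprD.
- apply/matrixP => i j; rewrite !mxE (H1 _ _ _).1 //.
  by rewrite -(inj_eq enum_rank_inj) enum_valK eq_sym neq_lift.
- apply/matrixP => i j; rewrite !mxE (H1 _ _ _).2 //.
  by rewrite -(inj_eq enum_rank_inj) enum_valK eq_sym neq_lift.
Qed.

Definition upd w (e : V * V) t : V * V -> L :=
  fun e' => if e' == e then t else w e'.

Lemma chi_upd z w e t :
  chi z (upd w e t) = (1 - t) * chi z (upd w e 0) + t * chi z (upd w e 1).
Proof.
case: e => a b; apply: (@chi_row_affine _ _ _ _ _ b) => [c d db|c].
  by rewrite /upd xpair_eqE (negPf db) andbF.
rewrite /upd; case: eqP => _; first by rewrite mulr0 add0r mulr1.
by rewrite -mulrDl subrK mul1r.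
Qed.

Definition cycw (c : seq V) : V * V -> L :=
  fun e => ((e.1 \in c) && (e.2 == next c e.1))%:R.

(** The indicator of [c] is a kernel vector: at [z = 1] each vertex of [c] takes the value of its
    successor. *)
Lemma chi_cycle c : c != [::] -> chi 1 (cycw c) = 0.
Proof.
case: c => // a0 c0 _; move: (a0 :: c0) (mem_head a0 c0) => c a0c.
apply/eqP/chi0P; exists (fun a => (a \in c)%:R) => [|a].
  by exists a0; rewrite a0c oner_neq0.
rewrite /dw if_same mul1r (bigD1 (next c a)) //= /cycw /= eqxx andbT.
rewrite mem_next -natrM mulnb andbb big1 ?addr0 // => b /negPf ->.
by rewrite andbF mul0r.
Qed.

Lemma polyfun_chi I (z : (I -> L) -> L) (w : (I -> L) -> V * V -> L) :
  polyfun z -> (forall e, polyfun (fun x => w x e)) ->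
  polyfun (fun x => chi (z x) (w x)).
Proof.
move=> pz pw; apply: polyfun_det => i j.
apply: (@polyfun_ext _ _ (fun x => (if (i == j) then dw (z x) (enum_val i)
  else 0)
   + (- w x (enum_val j, enum_val i)))).
  apply: polyfun_add; last exact: (polyfun_opp (pw _)).
  case: (i == j); last exact: polyfun_cst.
  by rewrite /dw; case: (X _); [exact: pz|exact: polyfun_cst].
by move=> x; rewrite mxE; case: (i == j).
Qed.

End WeightedDigraph.

(** * Disjoint spectra and the Sylvester operator *)

(** The transpose is there because eigenvectors are rows: [u^T *m v] lies in the kernel for
    eigenvectors [u] of [M] and [v] of [N] with equal eigenvalue. *)
Definition sylvester_op (F : fieldType) n (M N : 'M[F]_n) : 'M[F]_(n * n) :=
  lin_mulmx M^T - lin_mulmxr N.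

Lemma mul_sylvester_op (F : fieldType) n (M N Y : 'M[F]_n) :
  mxvec Y *m sylvester_op M N = mxvec (M^T *m Y - Y *m N).
Proof. by rewrite mulmxBr !mul_vec_lin linearB. Qed.

Lemma sylvester_op_common (F : fieldType) n (M N : 'M[F]_n) a :
  eigenvalue M a -> eigenvalue N a -> \det (sylvester_op M N) = 0.
Proof.
move=> /eigenvalueP[u uM u0] /eigenvalueP[v vN v0].
apply/eqP/det0P; exists (mxvec (u^T *m v)); last first.
  rewrite mul_sylvester_op mulmxA -trmx_mul uM -mulmxA vN.
  by rewrite linearZ /= -scalemxAl -scalemxAr subrr linear0.
rewrite mxvec_eq0; have /rV0Pn[i ui] := u0; have /rV0Pn[j vj] := v0.
apply: contraNneq ui => /matrixP/(_ i j)/eqP.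
by rewrite mxE big_ord1 !mxE mulf_eq0 (negPf vj) orbF.
Qed.

(** A kernel element [Y] intertwines [M^T] and [N], hence also their values under any polynomial.
    The characteristic polynomials are coprime, and a Bezout identity with Cayley-Hamilton forces
    [Y = 0]. *)
Lemma sylvester_op_coprime (F : closedFieldType) n (M N : 'M[F]_n) :
  (forall a, eigenvalue M a -> ~~ eigenvalue N a) ->
    \det (sylvester_op M N) != 0.
Proof.
case: n M N => [|n] M N MN.
  by apply/det0P => -[v]; rewrite (thinmx0 v) eqxx.
apply/det0P => -[v v0]; rewrite -[v]vec_mxK mul_sylvester_op => /eqP.
rewrite mxvec_eq0 subr_eq0 => /eqP; set Y := vec_mx v => MYN.
have Y0 : Y != 0 by rewrite vec_mx_eq0.
have pY (p : {poly F}) : horner_mx M^T p *m Y = Y *m horner_mx N p.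
  elim/poly_ind: p => [|p c IH]; first by rewrite !rmorph0 mul0mx mulmx0.
  rewrite !rmorphD !rmorphM /= !horner_mx_X !horner_mx_C mulmxDl mulmxDr.
  rewrite -!mulmxE -mulmxA MYN mulmxA IH mulmxA; congr (_ + _).
  by rewrite mul_scalar_mx mul_mx_scalar.
have cop : coprimep (char_poly M^T) (char_poly N).
  apply: contraT; rewrite coprimep_def => /closed_rootP[a].
  rewrite root_gcd => /andP[r1 r2].
  have rM : root (char_poly M) a.
    move: r1; rewrite /char_poly -(det_tr (char_poly_mx M)).
    by rewrite /char_poly_mx linearB /= tr_scalar_mx map_trmx.
  by have := MN a; rewrite !eigenvalue_root_char rM r2 => /(_ isT).
have /Bezout_eq1_coprimepP[[u1 u2] /= e] := cop.
have : Y *m horner_mx N 1 = 0.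
  rewrite -e rmorphD /= [u1 * _]mulrC !rmorphM /= Cayley_Hamilton mulr0 addr0.
  by rewrite -mulmxE mulmxA -pY Cayley_Hamilton !mul0mx.
by rewrite rmorph1 mulmx1; apply/eqP.
Qed.

Lemma polymx_sylvester_op (F : fieldType) I n (M N : (I -> F) -> 'M[F]_n) :
  polymx M -> polymx N -> polymx (fun x => sylvester_op (M x) (N x)).
Proof.
move=> pM pN i j; case/mxvec_indexP: j => j k.
(* Row [i] of the operator is its value on the basis matrix [D]. *)
pose D : 'M[F]_n := vec_mx (delta_mx 0 i).
apply: (@polyfun_ext _ _ (fun x => ((M x)^T *m D) j k + - (D *m N x) j k)).
  apply: polyfun_add.
    apply: polymx_mul => [a b|]; last exact: polymx_cst.
    by apply: (polyfun_ext (pM b a)) => x; rewrite mxE.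
  by apply: (@polyfun_opp _ _ (fun x => (D *m N x) j k));
    apply: polymx_mul => //; exact: polymx_cst.
move=> x; have := congr1 (fun v : 'rV_(n * n) => v 0 (mxvec_index j k))
  (mul_sylvester_op (M x) (N x) D).
by rewrite /= mxvecE vec_mxK -rowE !mxE => ->.
Qed.

Lemma map_sylvester_op (F K : fieldType) (phi : {rmorphism F -> K}) n
    (M N : 'M[F]_n) :
  map_mx phi (sylvester_op M N) = sylvester_op (map_mx phi M) (map_mx phi N).
Proof.
rewrite map_mxB; congr (_ - _); apply: map_lin_mx => Y; rewrite map_mxM //.
by rewrite map_trmx.
Qed.

(** * Fixed sets of edges *)

Definition mix (F : nmodType) (V : finType) (E S : {set V * V})
    (sg th : V * V -> F) : V * V -> F :=
  fun e => if e \in E then (if e \in S then sg e else th e) else 0.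

Section FixedModes.
Variables (L : closedFieldType) (V : finType) (X : pred V) (E : {set V * V}).
Hypothesis L0 : [pchar L] =i pred0.
Variables (n : nat) (M : (V * V -> L) -> 'M[L]_n).
Hypothesis polymxM : forall I (w : (I -> L) -> V * V -> L),
  (forall e, polyfun (fun x => w x e)) -> polymx (fun x => M (w x)).
Hypothesis eigenvalueM : forall z w, (forall e, e \notin E -> w e = 0) ->
  eigenvalue (M w) z = (chi X z w == 0).
Implicit Types (z : L) (S : {set V * V}) (th sg tau : V * V -> L).

Local Notation mix := (mix E).

Definition fixed S := forall th, exists z, forall sg, chi X z (mix S sg th) = 0.

(** A polynomial in all weights, so that two choices on [S] having no common zero becomes a generic
    condition on [th]. *)
Definition modes_det S th sg tau :=
  \det (sylvester_op (M (mix S sg th)) (M (mix S tau th))).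

Lemma eigenvalue_mix S sg th z :
  eigenvalue (M (mix S sg th)) z = (chi X z (mix S sg th) == 0).
Proof. by rewrite eigenvalueM // => e /negPf Ee; rewrite /mix Ee. Qed.

Lemma polyfun_mix I S (sg th : (I -> L) -> V * V -> L) e :
  polyfun (fun x => sg x e) -> polyfun (fun x => th x e) ->
  polyfun (fun x => mix S (sg x) (th x) e).
Proof.
rewrite /mix; case: (e \in E) => ps pt; last exact: polyfun_cst.
by case: (e \in S).
Qed.

Lemma polyfun_modes_det I S (th sg tau : (I -> L) -> V * V -> L) :
  (forall e, polyfun (fun x => th x e)) ->
    (forall e, polyfun (fun x => sg x e)) ->
  (forall e, polyfun (fun x => tau x e)) ->
  polyfun (fun x => modes_det S (th x) (sg x) (tau x)).
Proof.
by move=> pth psg ptau; apply/polyfun_det/polymx_sylvester_op;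
  apply: polymxM => e; apply: polyfun_mix.
Qed.

Lemma modes_det_neq0 S th sg tau : modes_det S th sg tau != 0 ->
  forall z, exists sg', chi X z (mix S sg' th) != 0.
Proof.
move=> D z; apply: contrapT => /forallNP H; move: D; rewrite /modes_det.
by rewrite (@sylvester_op_common _ _ _ _ z) ?eqxx // eigenvalue_mix;
  apply/negPn/negP/H.
Qed.

(** With zero weights on [S] there are finitely many eigenvalues. Each is avoided by some weights on
    [S], so some [tau] avoids all of them at once. *)
Lemma not_fixed S : ~ fixed S -> exists th sg tau, modes_det S th sg tau != 0.
Proof.
move=> /existsNP[th /forallNP H]; pose M0 := M (mix S (fun=> 0) th).
have [r Hr] := closed_field_poly_normal (char_poly M0).
have [||tau Htau] := @polyfun_nz_seq _ L0 _ _ r (fun z sg => chi X z (mix S sg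
  th)).
- move=> z; apply: polyfun_chi => [|e]; first exact: polyfun_cst.
  by apply: polyfun_mix; [exact: polyfun_proj|exact: polyfun_cst].
- by move=> z _; have /existsNP[sg /eqP] := H z; exists sg.
exists th, (fun=> 0), tau; apply: sylvester_op_coprime => z.
rewrite eigenvalue_root_char -/M0 Hr eigenvalue_mix => zr; apply: Htau.
move: zr; rewrite (monicP (char_poly_monic M0)) scale1r root_prod_XsubC.
by [].
Qed.

Section Edge.
Variables (S : {set V * V}) (e : V * V).
Hypotheses (eE : e \in E) (eS : e \notin S).

Lemma mix_upd sg th t : mix S sg (upd th e t) =1 upd (mix S sg th) e t.
Proof.
move=> e'; rewrite /mix /upd; case: eqP => [->|//].
by rewrite eE (negPf eS).
Qed.

Lemma mix_setU1 sg th : mix (e |: S) sg th =1 mix S sg (upd th e (sg e)).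
Proof.
move=> e'; rewrite /mix /upd in_setU1; case: eqP => [->|//].
by rewrite (negPf eS).
Qed.

(* The root fixed by all gains moves injectively with the weight [t] of [e],
   so [(1 - t) chi_0 + t chi_1] having a root independent of [sg] for every [t]
   makes the ratio of [chi_0] and [chi_1] independent of [sg]. *)
Lemma ratio_indep th z sg sg' : fixed S ->
  (forall z, exists tau, chi X z (mix (e |: S) tau th) != 0) ->
  chi X z (mix S sg (upd th e 0)) * chi X z (mix S sg' (upd th e 1)) =
  chi X z (mix S sg' (upd th e 0)) * chi X z (mix S sg (upd th e 1)).
Proof.
move=> FS good.
pose c z sg t := chi X z (mix S sg (upd th e t)).
have cE z1 sg1 t : c z1 sg1 t = (1 - t) * c z1 sg1 0 + t * c z1 sg1 1.
  by rewrite /c !(eq_chi _ _ (mix_upd _ _ _)) chi_upd.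
have [zf Hzf] := choice (fun k : nat => FS (upd th e k%:R)).
(* If two weights of [e] shared a zero, affinity would make it a zero for every weight of [e], hence
   a common zero for [e |: S], against [good]. *)
have zf_inj : injective zf.
  move=> k l ekl; apply: (natr_inj_pchar0 L0); apply/eqP.
  apply: contraT => kl.
  have [tau] := good (zf k); rewrite (eq_chi _ _ (mix_setU1 _ _)).
  rewrite -/(c (zf k) tau (tau e)) cE.
  have h1 : c _ _ _ = _ := Hzf k tau; have h2 : c _ _ _ = _ := Hzf l tau;
    rewrite -ekl in h2.
  rewrite cE in h1; rewrite cE in h2.
  have e01 : c (zf k) tau 0 = c (zf k) tau 1.
    apply/eqP; rewrite -subr_eq0.
    have : (l%:R - k%:R) * (c (zf k) tau 0 - c (zf k) tau 1) == 0.
      set u := c _ _ 0 in h1 h2 *; set v := c _ _ 1 in h1 h2 *.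
      have -> : (l%:R - k%:R) * (u - v) = ((1 - k%:R) * u + k%:R * v) -
        ((1 - l%:R) * u + l%:R * v) by ring.
      by rewrite h1 h2 subrr.
    have lk : (l%:R - k%:R == 0 :> L) = false by rewrite subr_eq0 eq_sym
      (negPf kl).
    by rewrite mulf_eq0 lk.
  have e0 : c (zf k) tau 1 = 0 by rewrite -h1 e01; ring.
  by rewrite e01 e0 !mulr0 addr0 eqxx.
(* As a polynomial in [z], the difference of the two sides vanishes at the infinitely many points
   [zf k]. *)
pose H z := c z sg 0 * c z sg' 1 + - (c z sg' 0 * c z sg 1).
have [q Hq] : exists q : {poly L}, forall z, H z = q.[z].
  have pc sg1 t : polyfun (fun x : unit -> L => c (x tt) sg1 t).
    by apply: polyfun_chi => [|e']; [exact: polyfun_proj|exact: polyfun_cst].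
  have pH : polyfun (fun x : unit -> L => H (x tt)).
    apply: polyfun_add; first exact: polyfun_mul.
    by apply: (@polyfun_opp _ _ (fun x : unit ->
      L => c (x tt) sg' 0 * c (x tt) sg 1)); apply: polyfun_mul.
  have [q Hq] := polyfun_line (fun=> 'X) pH.
  by exists q => z1; rewrite -Hq hornerX.
have q0 : q = 0.
  apply: (poly0_inj_nat zf_inj) => k; rewrite -Hq /H.
  have h1 : c _ _ _ = _ := Hzf k sg; have h2 : c _ _ _ = _ := Hzf k sg';
    rewrite cE in h1; rewrite cE in h2.
  (* The coefficients [1 - k] and [k] are eliminated from the two vanishing combinations; for
     [k = 0] both values at weight 0 already vanish. *)
  have [k0|k0] := eqVneq (k%:R : L) 0.
    move: h1 h2; rewrite k0 subr0 !mul0r !addr0 !mul1r => -> ->.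
    by rewrite !mul0r subrr.
  apply: (mulfI k0); rewrite mulr0.
  set a := c _ _ _ in h1 *; set b := c _ _ _ in h2 *.
  set a1 := c _ _ _ in h1 *; set b1 := c _ _ _ in h2 *.
  have -> : k%:R * (a * b1 - b * a1) =
    a * ((1 - k%:R) * b + k%:R * b1) - b * ((1 - k%:R) * a + k%:R * a1) by ring.
  by rewrite h1 h2 !mulr0 subrr.
by apply/eqP; rewrite -subr_eq0; apply/eqP; have := Hq z; rewrite q0 horner0.
Qed.

(** Wherever [modes_det] is nonzero, [ratio_indep] applies. The difference of the two sides is
    polynomial in [th], so were it nonzero somewhere, both would be nonzero at a common point. *)
Lemma ratio_indep_generic th z sg sg' : fixed S -> ~ fixed (e |: S) ->
  chi X z (mix S sg (upd th e 0)) * chi X z (mix S sg' (upd th e 1)) =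
  chi X z (mix S sg' (upd th e 0)) * chi X z (mix S sg (upd th e 1)).
Proof.
move=> FS /not_fixed[th1 [s [t st]]]; apply/eqP; rewrite -subr_eq0.
apply: contraT => Hth.
pose D (y : V * V -> L) := modes_det (e |: S) y s t.
pose H (y : V * V -> L) :=
  chi X z (mix S sg (upd y e 0)) * chi X z (mix S sg' (upd y e 1)) +
  - (chi X z (mix S sg' (upd y e 0)) * chi X z (mix S sg (upd y e 1))).
have pD : polyfun D.
  by apply: polyfun_modes_det => e'; [exact: polyfun_proj|exact:
    polyfun_cst|exact: polyfun_cst].
have pc sg1 t1 : polyfun (fun y : V * V ->
  L => chi X z (mix S sg1 (upd y e t1))).
  apply: polyfun_chi => [|e']; first exact: polyfun_cst.
  apply: polyfun_mix; first exact: polyfun_cst.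
  by rewrite /upd; case: (e' == e); [exact: polyfun_cst|exact: polyfun_proj].
have pH : polyfun H.
  apply: polyfun_add; first exact: polyfun_mul.
  by apply: (@polyfun_opp _ _ (fun y : V * V ->
    L => chi X z (mix S sg' (upd y e 0)) * chi X z (mix S sg (upd y e 1))));
      apply: polyfun_mul.
have [y Dy] := polyfun_nz2 L0 pD pH st Hth.
by rewrite /H (ratio_indep z sg sg' FS) ?subrr ?eqxx //;
  exact: modes_det_neq0 Dy.
Qed.

End Edge.

End FixedModes.

(** * Cycles and fixed sets *)

Section Cycles.
Variables (V : finType).
Implicit Types (e : rel V) (c g : seq V).

(** A duplicate-free path from [b] back to [a] is closed by the edge [(a, b)]; the list ends at [a],
    where [next] wraps around to [b]. *)
Lemma cycle_through e a b : e a b -> connect e b a ->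
  exists c, [/\ ucycle e c, a \in c & next c a = b].
Proof.
move=> eab /connectP[p0 p0P ela]; rewrite ela in eab *.
case/shortenP: p0P eab => p ep up _ eab.
exists (b :: p); split; last 1 first.
- rewrite next_nth mem_last index_last //.
  by rewrite nth_default.
- by rewrite /ucycle up andbT /= rcons_path ep.
- exact: mem_last.
Qed.

(** Iterating [next c] from a vertex of [g] never leaves [g], and it visits all of [c]. *)
Lemma subcycle_full c g : uniq c -> g != [::] ->
  {in g, forall w, w \in c /\ next g w = next c w} -> {subset c <= g}.
Proof.
case: g => // w g uc _; move: (w :: g) (mem_head w g) => {}g wg H v vc.
have := fconnect_cycle (cycle_next uc) (H w wg).1 v; rewrite vc.
move=> /iter_findex <-; elim: (findex _ _ _) => //= k IH.
by rewrite -(H _ IH).2 mem_next.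
Qed.

End Cycles.

(** * Cycles inside and outside a set with the ratio property *)

Section Entangled.
Variables (L : closedFieldType) (V : finType) (X : pred V) (E : {set V * V}).
Hypothesis L0 : [pchar L] =i pred0.
Variables (S : {set V * V}).
Hypothesis ratio : forall e, e \in E -> e \notin S ->
  forall (th : V * V -> L) z sg sg',
  chi X z (mix E S sg (upd th e 0)) * chi X z (mix E S sg' (upd th e 1)) =
  chi X z (mix E S sg' (upd th e 0)) * chi X z (mix E S sg (upd th e 1)).
Implicit Types (w : V * V -> L) (c d g : seq V).

Let Er : rel V := [rel a b | (a, b) \in E].

Lemma cycw_neq0 c a b : (cycw L c (a, b) != 0) = (a \in c) && (b == next c a).
Proof. by rewrite /cycw /=; case: (_ && _); rewrite ?oner_neq0 ?eqxx. Qed.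

Lemma cycw_next c a : a \in c -> cycw L c (a, next c a) = 1.
Proof. by move=> ac; rewrite /cycw /= ac eqxx. Qed.

(** A cycle in the support of [w] would follow [c], hence be all of [c], including the missing edge
    at [a]. *)
Lemma chi_subcycle c w a : uniq c ->
  (forall e, w e != 0 -> cycw L c e != 0) -> a \in c -> w (a, next c a) = 0 ->
  chi X 1 w = 1.
Proof.
move=> uc wc ac wa; apply: chi_acyclic => b b' wb; apply/negP => con.
have [g [/andP[cg ug] bg nb]] := cycle_through (e := supp w) wb con.
have gc : {in g, forall v, v \in c /\ next g v = next c v}.
  move=> v vg; have := wc _ (next_cycle cg vg).
  by rewrite cycw_neq0 => /andP[-> /eqP].
have g0 : g != [::] by case: (g) bg.
have ag := subcycle_full uc g0 gc ac.
by have := next_cycle cg ag; rewrite /supp /= (gc a ag).2 wa eqxx.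
Qed.

Lemma cycle_edge c a : ucycle Er c -> a \in c -> (a, next c a) \in E.
Proof. by move=> /andP[cc _] ac; exact: (next_cycle cc ac). Qed.

Lemma mix_cycw c : ucycle Er c -> mix E S (cycw L c) (cycw L c) =1 cycw L c.
Proof.
move=> uc [a b]; rewrite /mix if_same; case: ifPn => // abE.
apply/esym/eqP; apply: contraNT abE; rewrite cycw_neq0 => /andP[ac /eqP ->].
exact: cycle_edge.
Qed.

Lemma upd_same (w : V * V -> L) e : upd w e (w e) =1 w.
Proof. by move=> e'; rewrite /upd; case: eqP => [->|]. Qed.

Lemma mixE (sg th sg' th' : V * V -> L) :
  sg =1 sg' -> th =1 th' -> mix E S sg th =1 mix E S sg' th'.
Proof. by move=> es et e; rewrite /mix es et. Qed.

Lemma cycle_pure c a b : ucycle Er c -> a \in c -> b \in c ->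
  (a, next c a) \notin S -> (b, next c b) \notin S.
Proof.
move=> uc ac bc aS; apply/negP => bS; have uniqc : uniq c by case/andP: uc.
have c0 : c != [::] by case: (c) ac.
(* The edge at [a] is switched off and on, with [cycw] or zero weights on [S]. The complete cycle
   has determinant 0, and both factors on the left lack an edge of [c], so the identity reads
   [1 = 0]. *)
have := ratio (cycle_edge uc ac) aS (cycw L c) 1 (cycw L c) (fun=> 0).
rewrite (@chi_subcycle c _ a) //; last first.
- by rewrite /mix (negPf aS) /upd eqxx if_same.
- move=> e; rewrite /mix; case: ifP => _; last by rewrite eqxx.
  by case: ifP => // _; rewrite /upd; case: ifP; rewrite ?eqxx.
rewrite (@chi_subcycle c _ b) //; last first.
- by rewrite /mix bS if_same.
- move=> e; rewrite /mix; case: ifP => _; last by rewrite eqxx.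
  case: ifP => [|_]; first by rewrite eqxx.
  by rewrite /upd; case: (e =P (a, next c a)) => [->|//];
    rewrite cycw_next // oner_neq0.
rewrite (@eq_chi _ _ _ _ (mix E S (cycw L c) (upd _ _ 1)) (cycw L c)).
  by rewrite chi_cycle // mulr0 mul1r => /eqP; rewrite oner_eq0.
move=> e; rewrite -(mix_cycw uc); apply: mixE => // e'.
by rewrite -{1}(cycw_next ac) upd_same.
Qed.

(* Cycles lie in [S] or avoid [S], so the closed walk would contain a cycle with
   all edges on the side of [(x, y)], hence all of [c]. *)
Lemma broken_cycle w c a x y : uniq c -> a \in c -> w (a, next c a) = 0 ->
  (forall e, w e != 0 -> e \in E) ->
  (forall e, (e \in S) = ((x, y) \in S) -> w e != 0 -> cycw L c e != 0) ->
  w (x, y) != 0 -> ~~ connect (supp w) y x.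
Proof.
move=> uc ac wa wE wc wxy; apply/negP => con.
have [g [/andP[cg ug] xg ng]] := cycle_through (e := supp w) wxy con.
have gE : ucycle Er g.
  by rewrite /ucycle ug andbT; apply: sub_cycle cg => p q; exact: wE.
have gS p : p \in g -> ((p, next g p) \in S) = ((x, y) \in S).
  move=> pg; rewrite -ng; apply/idP/idP; apply: contraLR.
    exact: (cycle_pure gE xg pg).
  exact: (cycle_pure gE pg xg).
have gc : {in g, forall p, p \in c /\ next g p = next c p}.
  move=> p pg; have := wc _ (gS p pg) (next_cycle cg pg).
  by rewrite cycw_neq0 => /andP[-> /eqP].
have g0 : g != [::] by case: (g) xg.
have ag := subcycle_full uc g0 gc ac.
by have := next_cycle cg ag; rewrite /supp /= (gc a ag).2 wa eqxx.
Qed.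

(** Both cycles are broken at their edges into [v]: [W sg t] puts weight [t] on that edge of [c],
    and [D] is [d] without its own. The ratio identity gives [W sg 1 = 0] for all [sg], while
    [W D 0 = 1] and [W (cycw L d) 0 = 0]. Affinity at [v] equates [W D 0 + W (cycw L d) 1] with
    [W D 1 + W (cycw L d) 0], that is, 1 with 0. *)
Lemma cycles_disjoint c d v : ucycle Er c -> ucycle Er d -> v \in c ->
  v \in d ->
  (v, next c v) \notin S -> (v, next d v) \in S -> False.
Proof.
move=> uc ud vc vd cS dS.
have uniqc : uniq c by case/andP: uc.
have uniqd : uniq d by case/andP: ud.
have c0 : c != [::] by case: (c) vc.
have d0 : d != [::] by case: (d) vd.
have {}cS x : x \in c -> (x, next c x) \notin S.
  by move=> xc; apply: (cycle_pure uc vc xc).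
have {}dS x : x \in d -> (x, next d x) \in S.
  by move=> xd; apply: contraLR dS => xS; apply: (cycle_pure ud xd vd).
pose a := prev c v; pose b := prev d v.
have ac : a \in c by rewrite mem_prev.
have bd : b \in d by rewrite mem_prev.
have av : next c a = v by rewrite next_prev.
have bv : next d b = v by rewrite next_prev.
pose W sg t := chi X 1 (mix E S sg (upd (cycw L c) (a, v) t)).
have aE : (a, v) \in E by rewrite -av cycle_edge.
have aS : (a, v) \notin S by rewrite -av cS.
have W01 : W (fun=> 0) 1 = 0.
  rewrite -[RHS](chi_cycle L X c0); apply: eq_chi => e.
  rewrite -[RHS]mix_cycw // /mix; case: ifP => // eE.
  have u1 : upd (cycw L c) (a, v) 1 =1 cycw L c.
    by rewrite -(cycw_next ac) av; exact: upd_same.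
  rewrite u1; case: ifP => // eS; apply/esym/eqP; apply/negP => /negP.
  case: e eS {eE} => x y eS; rewrite cycw_neq0 => /andP[xc /eqP yE].
  by move: (cS x xc); rewrite -yE eS.
have W00 : W (fun=> 0) 0 = 1.
  apply: (@chi_subcycle c _ a) => //.
    move=> e; rewrite /mix; case: ifP => _; last by rewrite eqxx.
    case: ifP => _; first by rewrite eqxx.
    by rewrite /upd; case: ifP => _; rewrite ?eqxx.
  by rewrite av /mix aE (negPf aS) /upd eqxx.
have W1 sg : W sg 1 = 0.
  have := ratio aE aS (cycw L c) 1 sg (fun=> 0).
  by rewrite -/(W _ 0) -/(W _ 0) -/(W _ 1) -/(W _ 1) W01 W00 mulr0 mul1r.
have mixE0 (sg th : V * V -> L) e : mix E S sg th e != 0 -> e \in E.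
  by apply: contraNT => /negPf eE; rewrite /mix eE.
have updc b' g e : upd (cycw L g) b' 0 e != 0 -> cycw L g e != 0.
  by rewrite /upd; case: ifP => // _; rewrite eqxx.
have noS sg x y : let w := mix E S sg (upd (cycw L c) (a, v) 0) in
    w (x, y) != 0 -> (x, y) \notin S -> ~~ connect (supp w) y x.
  move=> w wxy xyS; apply: (@broken_cycle w c a) => //.
  - by rewrite av /w /mix aE (negPf aS) /upd eqxx.
  - by move=> e; exact: mixE0.
  - move=> e eS we; have eE := mixE0 _ _ _ we.
    by move: we; rewrite /w /mix eE eS (negPf xyS); exact: updc.
pose D := upd (cycw L d) (b, v) 0.
have bS : (b, v) \in S by rewrite -bv dS.
have WD0 : W D 0 = 1.
  apply: chi_acyclic => x y wxy.
  have [xyS|] := boolP ((x, y) \in S); last exact: noS.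
  apply: (@broken_cycle _ d b) => //.
  - by rewrite bv /mix bS /D /upd eqxx if_same.
  - by move=> e; exact: mixE0.
  - move=> e eS we; have eE := mixE0 _ _ _ we.
    by move: we; rewrite /mix eE eS xyS; exact: updc.
(* All edges outside [S] are pruned, which leaves the cycle [d]. *)
have Wd0 : W (cycw L d) 0 = 0.
  rewrite -[RHS](chi_cycle L X d0); apply: chi_prune => x y.
  set w := mix _ _ _ _.
  have [xyS|xyS] := boolP ((x, y) \in S).
    by left; rewrite -mix_cycw // /w /mix xyS.
  have cd : cycw L d (x, y) = 0.
    apply/eqP; apply: contraNT xyS; rewrite cycw_neq0 => /andP[xd /eqP ->].
    exact: dS.
  have [w0|w0] := eqVneq (w (x, y)) 0; first by left; rewrite w0.
  by right; split=> //; apply: noS.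
(* The edges [(a, v)] and [(b, v)] enter the same vertex, hence no term of the
   determinant contains both. *)
pose H e := 2^-1 * (mix E S D (upd (cycw L c) (a, v) 0) e +
                    mix E S (cycw L d) (upd (cycw L c) (a, v) 1) e).
have n2 : (2 : L) != 0 by rewrite ((pcharf0P L).1 L0).
have half : 1 - 2^-1 = 2^-1 :> L.
  by apply: (mulfI n2); rewrite mulrBr mulr1 mulfV //; ring.
have halfK (x : L) : 2^-1 * (x + x) = x.
  by rewrite (_ : x + x = 2 * x) ?mulKf //; ring.
have off p q t t' : q != v -> mix E S D (upd (cycw L c) (a, v) t) (p, q) =
    mix E S (cycw L d) (upd (cycw L c) (a, v) t') (p, q).
  by move=> qv; rewrite /mix /D /upd !xpair_eqE (negPf qv) !andbF.
have H1 : chi X 1 H = (1 - 2^-1) * W D 0 + 2^-1 * W (cycw L d) 1.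
  apply: (@chi_row_affine _ _ _ _ _ _ _ _ v) => [p q qv|p].
    by rewrite /H -(off p q 0 1 qv) halfK.
  by rewrite /H mulrDr half.
have H2 : chi X 1 H = (1 - 2^-1) * W D 1 + 2^-1 * W (cycw L d) 0.
  apply: (@chi_row_affine _ _ _ _ _ _ _ _ v) => [p q qv|p].
    by rewrite /H -(off p q 0 1 qv) -(off p q 0 0 qv) (off p q 1 1 qv)
      -(off p q 0 1 qv) halfK.
  rewrite /H mulrDr half /mix; case: ifP => _; last by rewrite !mulr0.
  by case: ifP => _ //; rewrite addrC.
move: H2; rewrite H1 half WD0 !W1 Wd0 !mulr0 !addr0 mulr1 => /eqP.
by rewrite invr_eq0 (negPf n2).
Qed.

(** By [cycle_pure] the whole cycle [c] then avoids [S]. *)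
Definition outer v := exists c,
  [/\ ucycle Er c, v \in c & (v, next c v) \notin S].

(** The edge lies on a cycle through [v], and by [cycles_disjoint] that cycle cannot continue from
    [v] inside [S]. *)
Lemma outer_step v u : outer v -> (v, u) \in E -> connect Er u v ->
  (v, u) \notin S /\ outer u.
Proof.
move=> [c [uc vc cS]] vuE con.
have [d [ud vd du]] := cycle_through (e := Er) vuE con.
have vS : (v, u) \notin S.
  apply/negP; rewrite -du => dS; exact: (cycles_disjoint uc ud vc vd cS dS).
split=> //; exists d; split=> //; first by rewrite -du mem_next.
by apply: (cycle_pure ud vd _) => //; rewrite -?du ?mem_next // du.
Qed.

Lemma outer_connect v u : outer v -> connect Er v u -> connect Er u v ->
  outer u.
Proof.
move=> + /connectP[p]; elim: p v => [|x p IH] v /= ov; first by move=> _ ->.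
move=> /andP[vx px] uE uv; have ux : connect Er u x.
  exact: connect_trans uv (connect1 vx).
have xu : connect Er x u by apply/connectP; exists p.
apply: (IH x) => //; have [] // := outer_step ov vx.
exact: connect_trans xu uv.
Qed.

End Entangled.

(** * Maximal fixed sets and the feedback edges *)

Section FixedModesFeedback.
Variables (L : closedFieldType) (V : finType) (X : pred V) (E : {set V * V}).
Hypothesis L0 : [pchar L] =i pred0.
Variables (n : nat) (M : (V * V -> L) -> 'M[L]_n).
Hypothesis polymxM : forall I (w : (I -> L) -> V * V -> L),
  (forall e, polyfun (fun x => w x e)) -> polymx (fun x => M (w x)).
Hypothesis eigenvalueM : forall z w, (forall e, e \notin E -> w e = 0) ->
  eigenvalue (M w) z = (chi X z w == 0).

Let Er : rel V := [rel a b | (a, b) \in E].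

(** An edge on no closed walk does not influence the determinant, so its weight may vary freely. *)
Lemma fixed_noncycle (S : {set V * V}) a b : ~~ connect Er b a ->
  (a, b) \notin S ->
  fixed L X E S -> fixed L X E ((a, b) |: S).
Proof.
move=> nba abS FS th; have [z Hz] := FS th; exists z => sg.
have sub (w : V * V -> L) : (forall e, e \notin E -> w e = 0) ->
    chi X z w = chi X z (upd w (a, b) 0).
  move=> wE; apply: chi_prune => c d; rewrite /upd.
  case: ((c, d) =P (a, b)) => [[-> ->]|_]; [right|by left].
  split=> //; apply: contra nba; apply: connect_sub => p q pq.
  by apply: connect1; apply: contraNT pq => /wE; rewrite /supp /= => ->;
    rewrite eqxx.
have mixN S' sg' (e : V * V) : e \notin E -> mix E S' sg' th e = 0.
  by move=> /negPf eE; rewrite /mix eE.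
rewrite sub; last exact: mixN.
rewrite -[RHS](Hz sg) [RHS]sub; last exact: mixN.
apply: eq_chi => e; rewrite /upd; case: eqP => // /eqP eab.
by rewrite /mix in_setU1 (negPf eab).
Qed.

Lemma not_fixed_feedback (K : {set V * V}) :
  (exists w : V * V -> L, (forall e, e \notin E ->
    w e = 0) /\ chi X 0 w != 0) ->
  (forall a b, (a, b) \in E -> (a, b) \notin K -> X a \/ X b) ->
  (forall x, X x -> exists y u,
     [/\ (y, u) \in E, (y, u) \in K, connect Er x y & connect Er u x]) ->
  ~ fixed L X E K.
Proof.
move=> [w0 [w0E w0X]] touch scc /asboolP FK.
have [S /maxsetP[/asboolP FS Smax] KS] := maxset_exists (P := fun S => `[<
  fixed L X E S >]) FK.
have nFS e : e \notin S -> ~ fixed L X E (e |: S).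
  move=> eS /asboolP FeS; move: eS.
  by rewrite -(Smax _ FeS (subsetU1 _ _)) setU11.
have [/subsetP ES|] := boolP (E \subset S).
  have [z Hz] := FS (fun=> 0).
  (* At zero weights only the diagonal is left, and it is invertible unless [z] is 0. *)
  have z0 : z = 0.
    apply/eqP; have := Hz (fun=> 0); rewrite (@eq_chi _ _ _ _ _ (fun=> 0)).
      rewrite chi_zero => /eqP; apply: contraTT => z0.
      by rewrite prodf_seq_neq0; apply/allP => a _; rewrite /dw /=;
        case: (X a); rewrite ?oner_neq0.
    by move=> e; rewrite /mix !if_same.
  case/eqP: w0X; rewrite -[RHS](Hz w0) z0; apply: eq_chi => e; rewrite /mix.
  by case: ifPn => [/ES ->|/w0E].
case/subsetPn=> -[a b] abE abS.
have ratio e (eE : e \in E) (eS : e \notin S) th z sg sg' :=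
  ratio_indep_generic L0 polymxM eigenvalueM eE eS th z sg sg' FS (nFS e eS).
have ba : connect Er b a.
  by apply: contraT => nba; case: (nFS _ abS); apply: fixed_noncycle.
have [c [uc ac nab]] := cycle_through (e := Er) abE ba.
have oa : outer E S a by exists c; rewrite nab.
have ob : outer E S b.
  by apply: (outer_connect L0 ratio oa _ ba); apply: connect1.
(* Edges outside [K] have a state at one end, so some outer vertex is a state, and its component
   contains an edge [(y, u)] of [K]. *)
have [x [Xx ox]] : exists x, X x /\ outer E S x.
  have abK : (a, b) \notin K by apply: contra abS; apply: (subsetP KS).
  by case: (touch a b abE abK) => Xx; [exists a|exists b].
have [y [u [yuE yuK xy ux]]] := scc x Xx.
have oy : outer E S y.
  apply: (outer_connect L0 ratio ox xy).
  exact: connect_trans (connect1 yuE) ux.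
(* This edge starts at an outer vertex and lies on a closed walk, so it avoids [S], although [S]
   contains [K]. *)
have [/negP[]] := outer_step L0 ratio oy yuE (connect_trans ux xy).
exact: (subsetP KS).
Qed.

End FixedModesFeedback.

(** * Components and cycle covers *)

Section Components.
Variables (V : finType) (E : {set V * V}).
Let Er : rel V := [rel a b | (a, b) \in E].

Lemma scc_connect (S : {set V}) a b : is_scc E S -> a \in S -> b \in S ->
  connect Er a b.
Proof.
move=> /andP[_ /maxsetp /forall_inP H] aS bS.
have := forall_inP (H a aS) b bS; apply: connect_sub => p q /and3P[_ _ pq].
exact: connect1.
Qed.

Lemma connected_component_scc a :
  is_scc E [set b | connect Er a b && connect Er b a].
Proof.
set T := [set b | _]; apply/andP; split.
  by apply/set0Pn; exists a; rewrite inE !connect0.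
apply/maxsetP; split=> [|B /forall_inP HB TB]; last first.
  have aB : a \in B by apply: (subsetP TB); rewrite inE !connect0.
  apply/eqP; rewrite eqEsubset TB andbT; apply/subsetP => b bB; rewrite inE.
  have sub p q : p \in B -> q \in B -> connect Er p q.
    move=> pB qB; have := forall_inP (HB p pB) q qB.
    by apply: connect_sub => c d /and3P[_ _ cd]; exact: connect1.
  by rewrite !sub.
apply/forall_inP => b bT; apply/forall_inP => c cT.
have : connect Er b c.
  move: bT cT; rewrite !inE => /andP[_ ba] /andP[ac _];
    exact: connect_trans ba ac.
(* Each vertex of the path is reachable from [a] and reaches [c], hence [a]; so the path stays
   inside [T], as strong connectedness demands. *)
case/connectP=> q; elim: q b bT => [|d q IH] b bT /=.
  by move=> _ ->; exact: connect0.
move=> /andP[bd dq] e.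
have dT : d \in T.
  move: bT cT; rewrite !inE => /andP[ab _] /andP[_ ca]; apply/andP; split.
    exact: connect_trans ab (connect1 bd).
  by apply: connect_trans ca; apply/connectP; exists q.
apply: connect_trans (IH d dT dq e); apply: connect1 => /=.
by rewrite bT dT.
Qed.

End Components.

Section PermutationCycles.
Variables (V : finType) (X : pred V) (E : {set V * V}) (F : fieldType).

(** Some Leibniz term is nonzero; its permutation is inverted because rows stand for heads of edges.
    At [z = 0] the diagonal entry of a state is only its loop, so a fixed point without a loop is
    not a state. *)
Lemma chi0_permutation (w : V * V -> F) : (forall e, e \notin E -> w e = 0) ->
  chi X 0 w != 0 -> exists2 g : V -> V, injective g &
    forall a, (a, g a) \in E \/ g a = a /\ ~~ X a.
Proof.
move=> wE; have [/existsP[s /forallP Hs]|] :=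
  boolP [exists s : {perm 'I_#|V|}, [forall i, pmx X 0 w i (s i) != 0]].
  move=> _; exists (fun a => enum_val ((s^-1)%g (enum_rank a))) => [a b
    /enum_val_inj/perm_inj/enum_rank_inj //|a].
  have := Hs ((s^-1)%g (enum_rank a)); rewrite mxE permKV enum_rankK.
  have [e|ne] := eqVneq ((s^-1)%g (enum_rank a)) (enum_rank a).
    rewrite e enum_rankK /dw; case: ifPn => Xa H; last by right.
    left; apply: contraT => /wE w0; move: H; rewrite w0 mulr1n subrr eqxx.
    by [].
  rewrite mulr0n sub0r oppr_eq0 => H; left; apply: contraT => /wE w0.
  by rewrite w0 eqxx in H.
rewrite negb_exists => /forallP H; rewrite /chi /determinant big1 ?eqxx // =>
  s _.
have := H s; rewrite negb_forall => /existsP[i]; rewrite negbK => /eqP Hi.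
by rewrite (bigD1 i) //= Hi mul0r mulr0.
Qed.

(** Only orbits meeting [X] are kept, one per canonical representative. A fixed point without a loop
    is an orbit of its own outside [X], so it never occurs in them. *)
Lemma permutation_cycles (g : V -> V) : injective g ->
  (forall a, (a, g a) \in E \/ g a = a /\ ~~ X a) ->
  exists (k : nat) (c : 'I_k -> seq V),
    [/\ forall j, is_cycle E (c j),
        forall j1 j2 v, v \in c j1 -> v \in c j2 -> j1 = j2 &
        forall x, X x -> exists j, x \in c j].
Proof.
move=> gi gE; have gsym := fconnect_sym gi.
pose reps := [set froot g x | x in [set x | X x]].
exists #|reps|, (fun j => fingraph.orbit g (enum_val j)); split.
- move=> j; have /imsetP[x] := enum_valP j; rewrite inE => Xx ->; split.
    by move/(congr1 size); rewrite fingraph.size_orbit;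
      have := fingraph.order_gt0 g (froot g x); case: (fingraph.order _ _).
  rewrite /ucycle fingraph.orbit_uniq andbT.
  apply: (@sub_in_cycle _ [in fingraph.orbit g (froot g x)] (frel g));
    last 2 first.
  - by apply/allP => a.
  - exact: fingraph.cycle_orbit.
  move=> a b ao _ /= /eqP <-; have [//|[ga /negP[]]] := gE a.
  suff -> : a = x by [].
  have ax : fconnect g a x.
    move: ao; rewrite unfold_in -fconnect_orbit gsym => ao.
    apply: connect_trans ao _; rewrite gsym; exact: connect_root.
  by have := iter_findex ax; rewrite iter_fix.
- move=> j1 j2 v; rewrite -!fconnect_orbit => v1 v2; apply: enum_val_inj.
  have rr (j : 'I_#|reps|) : froot g (enum_val j) = enum_val j.
    by have /imsetP[x _ ->] := enum_valP j; exact: (root_root gsym).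
  rewrite -(rr j1) -(rr j2); apply/(fingraph.rootP gsym).
  by apply: connect_trans v1 _; rewrite gsym.
- move=> x Xx; have xr : froot g x \in reps by apply/imsetP; exists x;
    rewrite ?inE.
  exists (enum_rank_in xr (froot g x)); rewrite enum_rankK_in //.
  by rewrite -fconnect_orbit gsym connect_root.
Qed.

End PermutationCycles.

(** * The closed loop as a weighted digraph *)

Section ClosedLoop.
Variables (n p m : nat).
Let V := vertex n p m.
Local Notation sx := (@state_vertex n p m).
Local Notation su := (@input_vertex n p m).
Local Notation sy := (@output_vertex n p m).

Definition is_state (v : V) : bool := if v is inl (inl _) then true else false.

Definition loop_weight (F : nzRingType) (A : 'M[F]_n) (B : 'M[F]_(n, p))
    (C : 'M[F]_(m, n)) (K : 'M[F]_(p, m)) (e : V * V) : F :=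
  match e with
  | (inl (inl j), inl (inl i)) => A i j
  | (inl (inl j), inr k) => C k j
  | (inl (inr l), inl (inl i)) => B i l
  | (inr k, inl (inr l)) => K l k
  | _ => 0
  end.

Lemma sum_vertex (F : nmodType) (f : V -> F) :
  \sum_v f v = \sum_i f (sx i) + \sum_l f (su l) + \sum_k f (sy k).
Proof. by rewrite !big_sumType. Qed.

(** A row eigenvector [v] extends by [v *m B] to the inputs and by [v *m B *m K] to the outputs.
    Conversely, the equations at inputs and outputs, where the diagonal is 1, force these values. *)
Lemma eigenvalue_chi (F : fieldType) (A : 'M[F]_n) (B : 'M[F]_(n, p))
    (C : 'M[F]_(m, n)) (K : 'M[F]_(p, m)) z :
  eigenvalue (A + B *m K *m C) z =
  (chi is_state z (loop_weight A B C K) == 0).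
Proof.
have row k (v : 'rV[F]_n) (N : 'M[F]_(n, k)) j :
  (v *m N) 0 j = \sum_i N i j * v 0 i.
  by rewrite mxE; apply: eq_bigr => i _; rewrite mulrC.
apply/eigenvalueP/chi0P => [[v vM v0]|[f [a fa] fP]].
  pose f (a : V) := match a with
    | inl (inl i) => v 0 i
    | inl (inr l) => (v *m B) 0 l
    | inr k => (v *m B *m K) 0 k end.
  exists f; first by have /rV0Pn[i vi] := v0; exists (sx i).
  move=> [[j|l]|k]; rewrite /dw /= sum_vertex /=.
  - have /rowP/(_ j) := vM; rewrite mulmxDr !mulmxA !mxE => <-.
    rewrite [X in _ + X + _]big1 ?addr0; last by move=> l _; rewrite mul0r.
    congr (_ + _); first by apply: eq_bigr => i _; rewrite mulrC.
    by apply: eq_bigr => k _; rewrite mulrC.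
  - rewrite [X in _ + X + _]big1; last by move=> i _; rewrite mul0r.
    rewrite [X in _ + _ + X]big1; last by move=> i _; rewrite mul0r.
    by rewrite !addr0 mul1r row.
  - rewrite [X in X + _ + _]big1; last by move=> i _; rewrite mul0r.
    rewrite [X in _ + _ + X]big1; last by move=> i _; rewrite mul0r.
    rewrite addr0 add0r mul1r mxE; apply: eq_bigr => l _; exact: mulrC.
pose v := \row_i f (sx i).
have fu l : f (su l) = (v *m B) 0 l.
  have := fP (su l); rewrite /dw /= sum_vertex /= mul1r => ->.
  rewrite [X in _ + X + _]big1; last by move=> i _; rewrite mul0r.
  rewrite [X in _ + _ + X]big1; last by move=> i _; rewrite mul0r.
  by rewrite !addr0 row; apply: eq_bigr => i _; rewrite mxE.
have fy k : f (sy k) = (v *m B *m K) 0 k.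
  have := fP (sy k); rewrite /dw /= sum_vertex /= mul1r => ->.
  rewrite [X in X + _ + _]big1; last by move=> i _; rewrite mul0r.
  rewrite [X in _ + _ + X]big1; last by move=> i _; rewrite mul0r.
  rewrite addr0 add0r mxE; apply: eq_bigr => l _.
  by rewrite -/(su l) fu mulrC.
exists v.
  apply/rowP => j; have := fP (sx j); rewrite /dw /= sum_vertex /=.
  rewrite [X in _ + X + _]big1 ?addr0; last by move=> l _; rewrite mul0r.
  move=> e; rewrite mulmxDr !mulmxA mxE [RHS]mxE [in RHS]mxE e; congr (_ + _).
    by rewrite row; apply: eq_bigr => i _; rewrite [in LHS]mxE.
  by rewrite mxE; apply: eq_bigr => k _; rewrite -/(sy k) fy mulrC.
apply: contraNneq fa => v0; have f0 i : f (sx i) = 0.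
  by have /rowP/(_ i) := v0; rewrite !mxE.
by case: a => [[i|l]|k]; [rewrite f0|rewrite fu v0 !mul0mx mxE|rewrite fy v0
  !mul0mx mxE].
Qed.

Variables (Abar : 'M[bool]_n) (Bbar : 'M[bool]_(n, p)) (Cbar : 'M[bool]_(m, n)).
Variables (links failed : {set 'I_m * 'I_p}).
Let E := system_edges Abar Bbar Cbar links failed.
Let Er : rel V := [rel a b | (a, b) \in E].

Definition sys_edge (e : V * V) : bool :=
  match e with
  | (inl (inl j), inl (inl i)) => Abar i j
  | (inl (inl j), inr k) => Cbar k j
  | (inl (inr l), inl (inl i)) => Bbar i l
  | (inr k, inl (inr l)) => ((k, l) \in links) && ((k, l) \notin failed)
  | _ => false
  end.

Lemma feedback_edgesE (e : V * V) : (e \in feedback_edges n links failed) =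
  if e is (inr k, inl (inr l)) then ((k, l) \in links) && ((k, l) \notin failed)
  else false.
Proof.
rewrite !inE andbC; case: e => a b; case: imsetP => [[[l k]]|H]; last first.
  move: H; case: a => [?|k] //; case: b => [[?|l]|?] //= H.
  apply/esym/negP => /andP[kl _]; case: H; exists (l, k) => //.
  by rewrite inE /= mxE.
rewrite inE /= mxE => kl [-> ->] /=; rewrite kl /=.
congr (~~ _); apply/imsetP/idP => [[[k' l'] ? /= [-> ->]] //|kf].
by exists (k, l).
Qed.

Lemma system_edgesE (e : V * V) : (e \in E) = sys_edge e.
Proof.
rewrite inE feedback_edgesE !inE -!orbA.
apply/idP/idP => [/or4P[/imsetP[[i j]]|/imsetP[[i j]]|/imsetP[[i j]]|]|].
- by rewrite inE => ? ->.
- by rewrite inE => ? ->.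
- by rewrite inE => ? ->.
- by case: e => -[[?|?]|?] [[?|?]|?].
case: e => -[[j|l]|k] [[i|l']|k'] //= H; apply/or4P.
- by constructor 1; apply/imsetP; exists (j, i); rewrite ?inE.
- by constructor 2; apply/imsetP; exists (k', j); rewrite ?inE.
- by constructor 3; apply/imsetP; exists (i, l); rewrite ?inE.
- by constructor 4.
Qed.

Definition mxA (F : nzRingType) (w : V * V -> F) : 'M[F]_n :=
  \matrix_(i, j) w (sx j, sx i).
Definition mxB (F : nzRingType) (w : V * V -> F) : 'M[F]_(n, p) :=
  \matrix_(i, l) w (su l, sx i).
Definition mxC (F : nzRingType) (w : V * V -> F) : 'M[F]_(m, n) :=
  \matrix_(k, j) w (sx j, sy k).
Definition mxK (F : nzRingType) (w : V * V -> F) : 'M[F]_(p, m) :=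
  \matrix_(l, k) w (sy k, su l).
Definition mxM (F : nzRingType) (w : V * V -> F) : 'M[F]_n :=
  mxA w + mxB w *m mxK w *m mxC w.

Lemma loop_weightK (F : nzRingType) (w : V * V -> F) :
  (forall e, e \notin E -> w e = 0) ->
  loop_weight (mxA w) (mxB w) (mxC w) (mxK w) =1 w.
Proof.
move=> wE [[[j|l]|k] [[i|l']|k']] /=; rewrite ?mxE //;
  by rewrite wE // system_edgesE.
Qed.

Lemma eigenvalue_mxM (F : fieldType) z (w : V * V -> F) :
  (forall e, e \notin E -> w e = 0) -> eigenvalue (mxM w) z = (chi is_state z
    w == 0).
Proof. by move=> wE; rewrite eigenvalue_chi (eq_chi _ _ (loop_weightK wE)). Qed.

Lemma polymx_mxM (F : fieldType) I (w : (I -> F) -> V * V -> F) :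
  (forall e, polyfun (fun x => w x e)) -> polymx (fun x => mxM (w x)).
Proof.
move=> pw.
have pmx r c (h : 'I_r -> 'I_c -> V * V) :
    polymx (fun x => \matrix_(i, j) w x (h i j) : 'M[F]_(r, c)).
  by move=> i j; apply: (polyfun_ext (pw (h i j))) => x; rewrite mxE.
by apply: polymx_add; [|apply: polymx_mul; [apply: polymx_mul|]]; apply: pmx.
Qed.

Lemma feedback_sccsP : states_in_feedback_sccs Abar Bbar Cbar links failed <->
  forall i, exists y u, [/\ (y, u) \in feedback_edges n links failed,
     connect Er (sx i) y & connect Er u (sx i)].
Proof.
split=> H i; have := H i.
  move=> [S [sS iS [[y u] [/= yu yS uS]]]]; exists y, u.
  by split=> //; [exact: scc_connect sS _ _|exact: scc_connect sS _ _].
move=> [y [u [yu iy ui]]]; have yuE : (y, u) \in E.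
  by rewrite system_edgesE; move: yu; rewrite feedback_edgesE;
    case: (y) (u) => [[?|?]|?] [[?|?]|?].
pose T : {set V} := [set b | connect Er (sx i) b && connect Er b (sx i)].
exists T; split.
- exact: connected_component_scc.
- by rewrite inE !connect0.
exists (y, u); split=> //=; rewrite inE ?iy ?ui ?andbT //=.
  exact: connect_trans (connect1 (yuE : Er y u)) ui.
exact: connect_trans iy (connect1 (yuE : Er y u)).
Qed.

Lemma chi0_cycles (F : fieldType) (w : V * V -> F) :
  (forall e, e \notin E -> w e = 0) -> chi is_state 0 w != 0 ->
  states_covered_by_disjoint_cycles Abar Bbar Cbar links failed.
Proof.
move=> wE /(chi0_permutation wE)[g gi gE].
have [k [c [cyc disj cov]]] := permutation_cycles gi gE.
by exists k, c; split=> // i; apply: cov.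
Qed.

(** The edges of the cycles get weight 1. Along them a kernel vector at [z = 0] is copied to the
    successor, or becomes 0 after a state. Outputs follow states, inputs follow outputs, and states
    follow states or inputs, so all values vanish in this order. Vertices off the cycles are no
    states and have no outgoing weight. *)
Lemma cycles_chi0 (F : fieldType) :
  states_covered_by_disjoint_cycles Abar Bbar Cbar links failed ->
  exists w : V * V -> F, (forall e, e \notin E ->
    w e = 0) /\ chi is_state 0 w != 0.
Proof.
move=> [k [c [cyc disj cov]]].
pose w (e : V * V) : F := [exists j,
  (e.1 \in c j) && (e.2 == next (c j) e.1)]%:R.
have cE j a : a \in c j -> (a, next (c j) a) \in E.
  by move=> ac; have [_ /andP[cc _]] := cyc j; exact: (next_cycle cc ac).
have cu j : uniq (c j) by have [_ /andP[]] := cyc j.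
exists w; split=> [[a b] abE|].
  rewrite /w; case: existsP => //= -[j /andP[ac /eqP e]].
  by move: abE; rewrite e cE.
apply/negP => /chi0P[f [a fa] fP]; move/negP: fa; apply.
have fnext j b : b \in c j -> dw is_state 0 b * f b = f (next (c j) b).
  move=> bc; rewrite fP (bigD1 (next (c j) b)) //= big1 => [|d db].
    rewrite addr0 /w; case: existsP => [_|[]]; first by rewrite mul1r.
    by exists j; rewrite bc eqxx.
  rewrite /w; case: existsP => [[j' /andP[/= bc' /eqP e]]|_];
    last by rewrite mul0r.
  by move: db; rewrite e (disj _ _ _ bc' bc) eqxx.
have fcov j b : b \in c j -> f b = 0.
  have prevP d : d \in c j -> [/\ prev (c j) d \in c j, (prev (c j) d,
    d) \in E &
      dw is_state 0 (prev (c j) d) * f (prev (c j) d) = f d].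
    move=> dc; have pc : prev (c j) d \in c j by rewrite mem_prev.
    split=> //; first by rewrite -{2}(next_prev (cu j) d) cE.
    by rewrite (fnext j) // next_prev.
  have fy k' : sy k' \in c j -> f (sy k') = 0.
    move=> /prevP[_ + <-]; case: (prev _ _) => [[i|l]|k2];
      rewrite system_edgesE //.
    by rewrite /dw /= mul0r.
  have fu l : su l \in c j -> f (su l) = 0.
    move=> /prevP[+ + <-]; case: (prev _ _) => [[i|l2]|k2];
      rewrite system_edgesE // => /fy yc _.
    by rewrite yc mulr0.
  case: b => [[i|l]|k']; [|exact: fu|exact: fy].
  move=> /prevP[+ + <-]; case: (prev _ _) => [[i2|l2]|k2];
    rewrite system_edgesE //.
    by rewrite /dw /= mul0r.
  by move=> /fu -> _; rewrite mulr0.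
have [/existsP[j ac]|nc] := boolP [exists j, a \in c j];
  first by rewrite (fcov j).
have Xa : ~~ is_state a.
  by case: (a) nc => [[i|]|] //; have [j ij] := cov i => /existsP[]; exists j.
have := fP a; rewrite /dw (negPf Xa) mul1r => ->; rewrite big1 // => b _.
rewrite /w; case: existsP => [[j /andP[/= ac _]]|_]; last by rewrite mul0r.
by case/existsP: nc; exists j.
Qed.

(** The mode is an eigenvalue of the state block of a component [T] without feedback edges. Edges
    between [T] and its complement lie on no closed walk, so an eigenvector of the block extends to
    a kernel vector for every [w]. *)
Lemma fixed_mode_of_scc (L : closedFieldType) (w0 : V * V -> L) :
  ~ states_in_feedback_sccs Abar Bbar Cbar links failed ->
  exists z, forall w : V * V -> L, (forall e, e \notin E -> w e = 0) ->
    (forall e, e \notin feedback_edges n links failed -> w e = w0 e) ->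
    chi is_state z w = 0.
Proof.
rewrite feedback_sccsP => /existsNP[i0 noF].
pose T : {set V} := [set b | connect Er (sx i0) b && connect Er b (sx i0)].
have noT y u : y \in T -> u \in T -> (y,
  u) \notin feedback_edges n links failed.
  move=> yT uT; apply/negP => yu; move: yT uT;
    rewrite !inE => /andP[iy _] /andP[_ ui].
  by case: noF; exists y, u.
pose TX := [set i | sx i \in T].
have iTX : i0 \in TX by rewrite !inE !connect0.
pose AT : 'M[L]_#|TX| := \matrix_(a, b) w0 (sx (enum_val b), sx (enum_val a)).
have [z] : exists z, root (char_poly AT) z.
  apply/closed_rootP; rewrite size_char_poly eqSS -lt0n card_gt0.
  by apply/set0Pn; exists i0.
rewrite -eigenvalue_root_char => /eigenvalueP[v vA v0]; exists z => w wE ww0.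
pose fx i := \sum_(a | enum_val a == i) v 0 a.
have fxT i : i \notin TX -> fx i = 0.
  move=> iT; rewrite /fx big_pred0 // => a; apply/eqP => e.
  by move: iT; rewrite -e enum_valP.
have fxv a : fx (enum_val a) = v 0 a.
  rewrite /fx (bigD1 a) //= big1 ?addr0 // => b /andP[/eqP/enum_val_inj ->].
  by rewrite eqxx.
(* Outputs may be zero: an edge from an output in [T] to an input in [T] would be a feedback edge
   inside [T]. *)
pose f (b : V) : L := match b with
  | inl (inl i) => fx i
  | inl (inr l) => if su l \in T then \sum_i w (su l, sx i) * fx i else 0
  | inr k => 0 end.
have fT b : b \notin T -> f b = 0.
  case: b => [[i|l]|k] //= bT; last by rewrite (negPf bT).
  by apply: fxT; rewrite inE.
pose w' (e : V * V) := if (e.1 \in T) == (e.2 \in T) then w e else 0.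
have -> : chi is_state z w = chi is_state z w'.
  apply: chi_prune => a b; rewrite /w' /=; case: eqP => abT; [by left|].
  have [w00|wab] := eqVneq (w (a, b)) 0; [by left|right; split=> //].
  apply/negP => ba; case: abT.
  have sE : forall c d, w (c, d) != 0 -> Er c d.
    by move=> c d; apply: contraNT => /wE ->.
  have {}ba : connect Er b a.
    by apply: connect_sub ba => c d cd; apply: connect1; apply: sE.
  have ab : connect Er a b by apply: connect1; apply: sE.
  rewrite !inE; apply/idP/idP => /andP[h1 h2]; apply/andP; split.
  - exact: connect_trans h1 ab.
  - exact: connect_trans ba h2.
  - exact: connect_trans h1 ba.
  - exact: connect_trans ab h2.
apply/eqP/chi0P; exists f.
  by have /rV0Pn[a va] := v0; exists (sx (enum_val a)); rewrite /= fxv.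
move=> a; have [aT|aT] := boolP (a \in T); last first.
  rewrite (fT _ aT) mulr0 big1 // => b _; rewrite /w' /= (negPf aT).
  by have [bT|bT] := boolP (b \in T); rewrite ?mul0r // fT ?mulr0.
rewrite (eq_bigr (fun b => w (a, b) * f b)); last first.
  move=> b _; rewrite /w' /= aT; have [//|bT] := boolP (b \in T).
  by rewrite fT // !mulr0.
rewrite sum_vertex; case: a aT => [[j|l]|k] aT; rewrite /dw /=.
- rewrite [X in _ + X + _]big1; last first.
    by move=> l _; rewrite wE ?mul0r // system_edgesE.
  rewrite [X in _ + _ + X]big1; last by move=> l _; rewrite mulr0.
  rewrite !addr0; have jT : j \in TX by rewrite inE.
  rewrite -{1}(enum_rankK_in jT jT) fxv.
  have /rowP/(_ (enum_rank_in jT j)) := vA; rewrite mxE [RHS]mxE => <-.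
  rewrite [RHS](bigID [in TX]) /= [X in _ + X]big1 ?addr0; last first.
    by move=> i iT; rewrite fxT // mulr0.
  rewrite [RHS]big_enum_val /=; apply: eq_bigr => b _.
  rewrite mxE enum_rankK_in // fxv mulrC ww0 // feedback_edgesE.
  by [].
- rewrite aT mul1r [X in _ + X + _]big1; last first.
    by move=> l' _; rewrite wE ?mul0r // system_edgesE.
  by rewrite [X in _ + _ + X]big1 ?addr0 // => k _; rewrite mulr0.
- rewrite mulr0 [X in X + _ + _]big1; last first.
    by move=> i _; rewrite wE ?mul0r // system_edgesE.
  rewrite [X in _ + _ + X]big1; last by move=> k' _; rewrite mulr0.
  rewrite addr0 add0r big1 // => l _; case: ifP => lT; last by rewrite mulr0.
  have := noT _ _ aT lT; rewrite feedback_edgesE => H.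
  by rewrite wE ?mul0r // system_edgesE.
Qed.

Lemma not_fixed_system (L : closedFieldType) : [pchar L] =i pred0 ->
  states_in_feedback_sccs Abar Bbar Cbar links failed ->
  states_covered_by_disjoint_cycles Abar Bbar Cbar links failed ->
  ~ fixed L is_state E (feedback_edges n links failed).
Proof.
move=> L0 /feedback_sccsP scc /(cycles_chi0 L) cov.
apply: (@not_fixed_feedback L V is_state E L0 n (@mxM L)) => //.
- by move=> I w; exact: polymx_mxM.
- by move=> z w; exact: eigenvalue_mxM.
- move=> [[?|?]|k] [[?|l]|?]; rewrite ?system_edgesE //=; try by [left|right].
  by move=> kl; rewrite feedback_edgesE kl.
- move=> [[i|//]|//] _; have [y [u [yu iy ui]]] := scc i.
  exists y, u; split=> //; rewrite system_edgesE; move: yu;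
    rewrite feedback_edgesE.
  by case: (y) (u) => [[?|?]|?] [[?|?]|?].
Qed.

End ClosedLoop.

From mathcomp Require Import classical_sets reals ereal topology normedtype
  complex.
From mathcomp Require Import measure lebesgue_measure lebesgue_integral.
Import numFieldNormedType.Exports.

(** * Nonzero sets of polynomial functions are not negligible *)

(* The integral of a nonnegative function is a supremum over simple functions
   below it, so monotonicity needs no measurability. *)
Lemma ge0_integral_mono d (T : measurableType d) (R : realType)
    (mu : {measure set T -> \bar R}) (f g : T -> \bar R) :
  (forall x, 0 <= f x)%E -> (forall x, f x <= g x)%E ->
  (\int[mu]_x f x <= \int[mu]_x g x)%E.
Proof.
move=> f0 fg; rewrite !ge0_integralTE //; last by move=> x;
  exact: le_trans (f0 x) (fg x).
by apply: ereal_sup_le => _ [h hf <-]; exists h => // x;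
  exact: le_trans (hf x) (fg x).
Qed.

Section LebesgueTuple.
Local Open Scope classical_set_scope.
Variable R : realType.

Lemma lebesgue_tuple_ge0 N (A : set (N.-tuple (measurableTypeR R))) :
  (0 <= lebesgue_tuple A)%E.
Proof.
elim: N A => [|N IH] A /=; first exact: measure_ge0.
by apply: integral_ge0 => x _; exact: IH.
Qed.

(** Proved for arbitrary sets by induction on sections, since [lebesgue_tuple] is a bare set
    function. *)
Lemma le_lebesgue_tuple N (A B : set (N.-tuple (measurableTypeR R))) :
  A `<=` B -> (lebesgue_tuple A <= lebesgue_tuple B)%E.
Proof.
elim: N A B => [|N IH] A B AB /=.
  by rewrite !diracE lee_fin ler_nat; case: (boolP (_ \in A)) => //
    /set_mem/AB/mem_set ->.
rewrite /product_measure1; apply: ge0_integral_mono => x /=.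
  exact: lebesgue_tuple_ge0.
apply: IH => t; rewrite /xsection /= !inE; exact: AB.
Qed.

Lemma lebesgue_tuple0 N :
  lebesgue_tuple (set0 : set (N.-tuple (measurableTypeR R))) = 0%E.
Proof.
elim: N => [|N IH] /=; first by rewrite dirac0.
rewrite /product_measure1 integral0_eq // => x _ /=.
by rewrite (_ : xsection _ _ = set0) //; apply/seteqP; split => // t;
  rewrite /xsection /= inE.
Qed.

Lemma polyfun_continuous N (f : ('I_N -> R) -> R) : polyfun f ->
  continuous (fun v : 'rV[R]_N => f (fun i => v ord0 i)).
Proof.
elim=> {f} [c|i|f g _ Hf _ Hg|f g _ Hf _ Hg|f g _ Hf fg] v.
- exact: cst_continuous.
- move=> A /nbhs_ballP[e e0 eA]; apply/nbhs_ballP; exists e => // w [_ vw].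
  exact/eA/vw.
- exact: cvgD (Hf v) (Hg v).
- exact: cvgM (Hf v) (Hg v).
- by rewrite (_ : g = f) //; apply/funext => x; rewrite fg.
Qed.

(** By continuity [f] is nonzero on a box around [t0], whose measure is a product of positive side
    lengths. *)
Lemma not_negligible_polyfun N (f : ('I_N -> R) -> R) (t0 : 'I_N -> R)
    (P : set (N.-tuple (measurableTypeR R))) :
  polyfun f -> f t0 != 0 -> (forall t, f (tnth t) != 0 -> P t) ->
  ~ (@lebesgue_tuple R N).-negligible P.
Proof.
move=> pf ft0 fP [Q [_ Q0 PQ]].
pose v0 : 'rV[R]_N := \row_i t0 i.
have fv0 : f (fun i => v0 ord0 i) = f t0.
  by apply: polyfun_eq_arg => // i; rewrite mxE.
have [/= e e0 Hb] : exists2 e : R, 0 < e & forall v : 'rV[R]_N,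
    (forall i, `|t0 i - v ord0 i| < e) -> f (fun i => v ord0 i) != 0.
  have := polyfun_continuous pf (x := v0) => /cvgr_neq0.
  rewrite fv0 => /(_ ft0) /nbhs_ballP[e /= e0 He]; exists e => // v vb.
  apply: He; split=> // i j; rewrite ord1 mxE; exact: vb.
pose I i : set (measurableTypeR R) := [set` `]t0 i - e, t0 i + e[%R].
pose box := [set t : N.-tuple (measurableTypeR R) | forall i, I i (tnth t i)].
have : (lebesgue_tuple box <= lebesgue_tuple Q)%E.
  apply: le_lebesgue_tuple => t Ht; apply/PQ/fP.
  rewrite (@polyfun_eq_arg _ _ _ _ (fun i => (\row_i tnth t i :
    'rV[R]_N) ord0 i) pf).
    by apply: Hb => i; rewrite mxE; have := Ht i;
      rewrite /I /= in_itv /= -ltr_distl distrC.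
  by move=> i; rewrite mxE.
rewrite Q0 (lebesgue_tuple_box (B := I)) => [|i]; last exact: measurable_itv.
apply/negP; rewrite -ltNge.
elim/big_ind: _ => [|x y|i _]; [exact: lte01|exact: mule_gt0|].
rewrite /I lebesgue_measure_itv /= lte_fin ltrD2l gt0_cp //.
by rewrite -EFinB lte_fin subr_gt0 ltrD2l gt0_cp.
Qed.

End LebesgueTuple.

(** * Generic parameters *)

Section FixedModesOfSystem.
Variables (R : realType) (n p m : nat).
Variables (Abar : 'M[bool]_n) (Bbar : 'M[bool]_(n, p)) (Cbar : 'M[bool]_(m, n)).
Variable links : {set 'I_m * 'I_p}.
Implicit Types (failed : {set 'I_m * 'I_p}).

Let cx := real_complex R.

Lemma loop_weight_support (F : nzRingType) (A : 'M[F]_n) (B : 'M[F]_(n, p))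
    (C : 'M[F]_(m, n)) (K : 'M[F]_(p, m)) failed :
  (forall i j, Abar i j = false -> A i j = 0) ->
  (forall i j, Bbar i j = false -> B i j = 0) ->
  (forall i j, Cbar i j = false -> C i j = 0) ->
  (forall l k, (k, l) \notin links \/ (k, l) \in failed -> K l k = 0) ->
  forall e, e \notin system_edges Abar Bbar Cbar links failed ->
    loop_weight A B C K e = 0.
Proof.
move=> sA sB sC sK [[[j|l]|k] [[i|l']|k']];
  rewrite system_edgesE //= => /negPf e.
- exact: sA.
- exact: sC.
- exact: sB.
- by apply: sK; move/negbT: e; rewrite negb_and negbK => /orP.
Qed.

Lemma fixed_mode_of_failure failed (A : 'M[R]_n) (B : 'M[R]_(n, p))
    (C : 'M[R]_(m, n)) :
  structured Abar A -> structured Bbar B -> structured Cbar C ->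
  ~ (states_in_feedback_sccs Abar Bbar Cbar links failed /\
     states_covered_by_disjoint_cycles Abar Bbar Cbar links failed) ->
  exists z, forall K, gains links failed K -> spectrum (A + B *m K *m C) z.
Proof.
move=> sA sB sC nab.
have spec K z : spectrum (A + B *m K *m C) z <->
    chi (@is_state n p m) z (loop_weight (map_mx cx A) (map_mx cx B) (map_mx
      cx C) (map_mx cx K)) = 0.
  rewrite /spectrum /= map_mxD !map_mxM eigenvalue_chi; split; by move/eqP.
have supp K : gains links failed K -> forall e,
    e \notin system_edges Abar Bbar Cbar links failed ->
    loop_weight (map_mx cx A) (map_mx cx B) (map_mx cx C) (map_mx cx K) e = 0.
  move=> gK; apply: loop_weight_support => i j h; rewrite mxE.
  - by rewrite sA // rmorph0.
  - by rewrite sB // rmorph0.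
  - by rewrite sC // rmorph0.
  - by rewrite gK // rmorph0.
have [scc|nscc] := pselect (states_in_feedback_sccs Abar Bbar Cbar links
  failed).
  exists 0 => K gK; apply/spec; apply: contrapT => /eqP chi0.
  by apply: nab; split=> //; apply: chi0_cycles (supp K gK) chi0.
(* Zero gains serve as the reference: off the feedback edges, the loop weights are the same for all
   admissible [K]. *)
have [z Hz] := fixed_mode_of_scc (loop_weight (map_mx cx A) (map_mx cx B)
  (map_mx cx C) 0) nscc.
exists z => K gK; apply/spec; apply: Hz; first exact: supp.
move=> [[[j|l]|k] [[i|l']|k']] //=; rewrite feedback_edgesE => kl.
rewrite !mxE gK ?rmorph0 //; move: kl; rewrite negb_and negbK; by move/orP.
Qed.

(** Non-fixedness is used over the complex numbers, where eigenvalues exist; the resulting weights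
    are then replaced by naturals, which are real. *)
Lemma generic_gains failed :
  states_in_feedback_sccs Abar Bbar Cbar links failed ->
  states_covered_by_disjoint_cycles Abar Bbar Cbar links failed ->
  exists (K1 K2 : 'M[R]_(p, m)) (A : 'M[R]_n) (B : 'M[R]_(n, p)) (C :
    'M[R]_(m, n)),
    [/\ gains links failed K1 /\ gains links failed K2,
        [/\ structured Abar A, structured Bbar B & structured Cbar C] &
        \det (sylvester_op (A + B *m K1 *m C) (A + B *m K2 *m C)) != 0].
Proof.
set E := system_edges Abar Bbar Cbar links failed.
set F := feedback_edges n links failed => scc cov.
have L0 : [pchar R[i]] =i pred0 by apply: pchar_num.
have [th0 [s0 [t0 D0]]] := not_fixed L0
  (@eigenvalue_mxM n p m Abar Bbar Cbar links failed R[i]) (not_fixed_system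
    L0 scc cov).
(* Three independent copies of the edges, for [th], [sg] and [tau]. *)
pose J := ('I_3 * (vertex n p m * vertex n p m))%type.
pose q0 : 'I_3 := inord 0; pose q1 : 'I_3 := inord 1; pose q2 : 'I_3 := inord 2.
pose f (x : J -> R[i]) := modes_det E (@mxM n p m R[i]) F
  (fun e => x (q0, e)) (fun e => x (q1, e)) (fun e => x (q2, e)).
have pf : polyfun f.
  by apply: polyfun_modes_det; [exact: polymx_mxM|..] => e; exact: polyfun_proj.
pose x0 (qe : J) := if qe.1 == q0 then th0 qe.2 else if qe.1 == q1 then s0
  qe.2 else t0 qe.2.
have [k Hk] : exists k : J -> nat, f (fun i => (k i)%:R) != 0.
  apply: (polyfun_nat_nz L0 (x := x0) pf).
  have -> : f x0 = modes_det E (@mxM n p m R[i]) F th0 s0 t0.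
    have q01 : (q1 == q0) = false by rewrite -val_eqE /= !inordK.
    have q02 : (q2 == q0) = false by rewrite -val_eqE /= !inordK.
    have q12 : (q2 == q1) = false by rewrite -val_eqE /= !inordK.
    by rewrite /f /x0 /= !eqxx q01 q02 q12.
  exact: D0.
(* Off the feedback edges all [w q] use the copy [q0], so [w q1] and [w q2] share [A], [B] and [C]
   and can differ only in the gains. *)
pose w (q : 'I_3) : vertex n p m * vertex n p m -> R :=
  mix E F (fun e => (k (q, e))%:R) (fun e => (k (q0, e))%:R).
have wE q e : e \notin E -> w q e = 0 by move=> /negPf eE; rewrite /w /mix eE.
have ww q e : e \notin F -> w q e = w q1 e.
  by move=> /negPf eF; rewrite /w /mix eF.
have gK q : gains links failed (mxK (w q)).
  move=> l kk h; rewrite mxE wE // system_edgesE /= negb_and negbK; exact/orP.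
exists (mxK (w q1)), (mxK (w q2)), (mxA (w q1)), (mxB (w q1)), (mxC (w q1)).
split; first by split; exact: gK.
  by split=> i j h; rewrite mxE wE // system_edgesE /= h.
have M2 : mxA (w q1) + mxB (w q1) *m mxK (w q2) *m mxC (w q1) = mxM (w q2).
  have [eA eB eC] : [/\ mxA (w q2) = mxA (w q1), mxB (w q2) = mxB (w q1) &
      mxC (w q2) = mxC (w q1)].
    by split; apply/matrixP => i j; rewrite !mxE ww // feedback_edgesE.
  by rewrite /mxM eA eB eC.
rewrite M2 -/(mxM (w q1)) -(fmorph_eq0 cx) -det_map_mx map_sylvester_op.
suff mapM q : map_mx cx (mxM (w q)) = mxM (mix E F (fun e => (k (q, e))%:R)
    (fun e => (k (q0, e))%:R)).
  by rewrite !mapM; exact: Hk.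
have wq e : cx (w q e) = mix E F (fun e => (k (q, e))%:R) (fun e => (k (q0,
  e))%:R) e.
  rewrite /cx /w /mix; case: ifP => _; last by rewrite rmorph0.
  by case: ifP => _; rewrite (rmorph_nat (real_complex R)).
rewrite map_mxD !map_mxM /mxM.
by congr (_ + _); [|congr (_ *m _); [congr (_ *m _)|]];
  apply/matrixP => i j; rewrite !mxE; exact: wq.
Qed.

Section FreeParams.
Let N := #|free_positions Abar Bbar Cbar|.

(** A sum with at most one term: the parameter at a free position, and 0 at the others. *)
Definition coef (F : nmodType) (t : 'I_N -> F) (q : position n p m) : F :=
  \sum_(k | enum_val k == q) t k.

Definition paramA (F : nmodType) (t : 'I_N -> F) : 'M[F]_n :=
  \matrix_(i, j) coef t (inl (inl (i, j))).
Definition paramB (F : nmodType) (t : 'I_N -> F) : 'M[F]_(n, p) :=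
  \matrix_(i, j) coef t (inl (inr (i, j))).
Definition paramC (F : nmodType) (t : 'I_N -> F) : 'M[F]_(m, n) :=
  \matrix_(i, j) coef t (inr (i, j)).

Lemma coef_enum_val (F : nmodType) (t : 'I_N -> F) k :
  coef t (enum_val k) = t k.
Proof.
rewrite /coef (bigD1 k) //= big1 ?addr0 // => l /andP[/eqP/enum_val_inj ->].
by rewrite eqxx.
Qed.

Lemma coef_notfree (F : nmodType) (t : 'I_N -> F) q :
  q \notin free_positions Abar Bbar Cbar -> coef t q = 0.
Proof.
move=> qN; rewrite /coef big_pred0 // => k; apply/eqP => e.
by move: qN; rewrite -e enum_valP.
Qed.

Lemma params_structured (t : 'I_N -> R) :
  [/\ structured Abar (paramA t), structured Bbar (paramB t) & structured Cbar
    (paramC t)].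
Proof. by split=> i j h; rewrite mxE coef_notfree // inE h. Qed.

Lemma entry_params (t : 'I_N -> R) q :
  entry (paramA t) (paramB t) (paramC t) q = coef t q.
Proof. by case: q => [[[i j]|[i j]]|[i j]]; rewrite /= mxE. Qed.

Lemma free_paramsK (t : N.-tuple (measurableTypeR R)) :
  free_params Abar Bbar Cbar (paramA (tnth t)) (paramB (tnth t)) (paramC (tnth
    t)) = t.
Proof.
by apply: eq_from_tnth => k; rewrite tnth_mktuple entry_params coef_enum_val.
Qed.

Lemma params_entry (A : 'M[R]_n) (B : 'M[R]_(n, p)) (C : 'M[R]_(m, n)) :
  structured Abar A -> structured Bbar B -> structured Cbar C ->
  let t (k : 'I_N) := entry A B C (enum_val k) in
  [/\ paramA t = A, paramB t = B & paramC t = C].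
Proof.
move=> sA sB sC t.
have cE q : coef t q = entry A B C q.
  have [qN|qN] := boolP (q \in free_positions Abar Bbar Cbar).
    by rewrite -(enum_rankK_in qN qN) coef_enum_val.
  rewrite coef_notfree //; move: qN; rewrite inE.
  by case: q => [[[i j]|[i j]]|[i j]] /negPf h; rewrite /= ?sA ?sB ?sC.
by split; apply/matrixP => i j; rewrite mxE cE.
Qed.

Lemma polyfun_coef (F : comNzRingType) q :
  polyfun (fun t : 'I_N -> F => coef t q).
Proof. by apply: polyfun_sum => k _; exact: polyfun_proj. Qed.

Lemma polyfun_param_det (K1 K2 : 'M[R]_(p, m)) : polyfun (fun t : 'I_N -> R =>
  \det (sylvester_op (paramA t + paramB t *m K1 *m paramC t)
                     (paramA t + paramB t *m K2 *m paramC t))).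
Proof.
have pA : polymx (fun t : 'I_N -> R => paramA t).
  by move=> i j; apply: (polyfun_ext (polyfun_coef R _)) => t; rewrite mxE.
have pB : polymx (fun t : 'I_N -> R => paramB t).
  by move=> i j; apply: (polyfun_ext (polyfun_coef R _)) => t; rewrite mxE.
have pC : polymx (fun t : 'I_N -> R => paramC t).
  by move=> i j; apply: (polyfun_ext (polyfun_coef R _)) => t; rewrite mxE.
apply/polyfun_det/polymx_sylvester_op; apply: polymx_add => //;
  apply: polymx_mul => //;
  by apply: polymx_mul => //; exact: polymx_cst.
Qed.

End FreeParams.
End FixedModesOfSystem.

Theorem theorem1 (R : realType) (n p m : nat)
    (Abar : 'M[bool]_n) (Bbar : 'M[bool]_(n, p)) (Cbar : 'M[bool]_(m, n))
    (links : {set 'I_m * 'I_p})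
    (Delta : Type) (Gamma : Delta -> {set 'I_m * 'I_p})
    (Gamma_sub : forall i : Delta, Gamma i \subset links) :
  ~ has_resilient_structurally_fixed_modes R Abar Bbar Cbar links Gamma <->
  (forall i : Delta,
     states_in_feedback_sccs Abar Bbar Cbar links (Gamma i) /\
     states_covered_by_disjoint_cycles Abar Bbar Cbar links (Gamma i)).
Proof.
split=> [nH i|H].
  (* A failing [i] gives a fixed mode to every triple, so the exceptional set is empty. *)
  apply: contrapT => ni; apply: nH; exists set0; split=> //.
    exact: lebesgue_tuple0.
  move=> t [A [B [C [[sA sB sC] noP _]]]]; apply: noP.
  have [z Hz] := fixed_mode_of_failure sA sB sC ni.
  by exists z; exists i => // K gK; exact: Hz.
pose ok failed := states_in_feedback_sccs Abar Bbar Cbar links failed /\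
  states_covered_by_disjoint_cycles Abar Bbar Cbar links failed.
pose D (K : 'M[R]_(p, m) * 'M[R]_(p, m))
    (t : 'I_#|free_positions Abar Bbar Cbar| -> R) :=
  \det (sylvester_op (paramA t + paramB t *m K.1 *m paramC t)
                     (paramA t + paramB t *m K.2 *m paramC t)).
(* Gains are chosen per failure set and not per index: [Delta] may be infinite, but there are
   finitely many failure sets, so the product of the determinants is a polynomial. *)
have /choice[KK HKK] : forall failed, exists K : 'M[R]_(p, m) * 'M[R]_(p, m),
    ok failed -> [/\ gains links failed K.1, gains links failed K.2 &
                     exists t, D K t != 0].
  move=> failed; have [[scc cov]|nok] := pselect (ok failed);
    last by exists (0, 0).
  have [K1 [K2 [A [B [C [[g1 g2] [sA sB sC] D0]]]]]] := generic_gains R scc cov.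
  exists (K1, K2) => _; split=> //.
  have [eA eB eC] := params_entry sA sB sC.
  by exists (fun k => entry A B C (enum_val k)); rewrite /D eA eB eC.
have R0 : [pchar R] =i pred0 by apply: pchar_num.
pose s := [seq failed <- enum {set 'I_m * 'I_p} | `[< ok failed >]].
have pD K : polyfun (D K) by exact: polyfun_param_det.
have [t0 Ht0] : exists t0, \prod_(failed <- s) D (KK failed) t0 != 0.
  have [//||t0 Ht0] := polyfun_nz_seq R0 (s := s)
      (G := fun failed => D (KK failed)).
    by move=> failed; rewrite mem_filter => /andP[/asboolP/HKK[]].
  by exists t0; rewrite prodf_seq_neq0; apply/allP => failed fs; rewrite Ht0.
apply: (not_negligible_polyfun
  (f := fun t => \prod_(failed <- s) D (KK failed) t) _ Ht0).
  by apply: polyfun_prod => failed _; exact: pD.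
move=> t Dt; exists (paramA (tnth t)), (paramB (tnth t)), (paramC (tnth t));
  split.
- exact: params_structured.
(* A mode common to all admissible gains would be shared by the two chosen ones, and their Sylvester
   determinant would vanish. *)
- move=> [z [i _ Hz]]; have [g1 g2 _] := HKK (Gamma i) (H i).
  have : D (KK (Gamma i)) (tnth t) != 0.
    move: Dt; rewrite prodf_seq_neq0 => /allP/(_ (Gamma i)); apply.
    by rewrite mem_filter mem_enum andbT; apply/asboolP; exact: H.
  rewrite -(fmorph_eq0 (real_complex R)) -det_map_mx map_sylvester_op.
  by rewrite (sylvester_op_common (Hz _ g1) (Hz _ g2)) eqxx.
- by rewrite free_paramsK.
Qed.
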